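(* Let $X$ be a L\'evy process with $X_0=0$ and let $0\le b<1$. Let $B(t)>0$ be a non-stochastic function such that $t\mapsto B(t)/t^b$ is continuous and strictly increasing, and let $C$ be the inverse of $t\mapsto B(t)/t^b$. (a) Suppose $X_t/B(t)\to 1$ in probability as $t\to 0$. Then, as $r\to 0$, each of the following converges to $1$ in probability: $$\frac{X_{\overline{T}_b(r)}}{r(\overline{T}_b(r))^b},\qquad \frac{X_{\overline{T}_b(r)}}{B(\overline{T}_b(r))},\qquad \frac{X_{\overline{T}_b(r)}}{B(C(r))},\qquad \frac{X_{\overline{T}_b(r)}}{r(C(r))^b}.$$ (b) Suppose $|X_t|/B(t)\to 1$ in probability as $t\to 0$. Then, as $r\to 0$, each of the following converges to $1$ in probability: $$\frac{|X_{T^*_b(r)}|}{r(T^*_b(r))^b},\qquad \frac{|X_{T^*_b(r)}|}{B(T^*_b(r))},\qquad \frac{|X_{T^*_b(r)}|}{B(C(r))},\qquad \frac{|X_{T^*_b(r)}|}{r(C(r))^b}.$$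
   Context: $X$ is a real-valued L\'evy process. For $r\ge 0$, $$\overline{T}_b(r)=\inf\{t\ge 0: X_t>rt^b\},\qquad T^*_b(r)=\inf\{t\ge 0:|X_t|>rt^b\},$$ with $\inf\emptyset=+\infty$ (and $t^0=1$ for all $t\ge0$). Under the hypotheses these times are finite with probability approaching 1 as $r\to0$, and the displayed ratios are understood on the event of finiteness. Limits as $t\to0$, $r\to0$ are from above; $B$, $C$ and the regularity of $B$ matter only on a right neighbourhood of $0$. *)

(* Defs.v *)
From HB Require Import structures.
From mathcomp Require Export all_boot all_order all_algebra.
From mathcomp Require Export all_classical all_reals all_analysis.
Export Order.TTheory GRing.Theory Num.Theory.
Export numFieldNormedType.Exports.

Set Implicit Arguments.
Unset Strict Implicit.
Unset Printing Implicit Defensive.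

Local Open Scope classical_set_scope.
Local Open Scope ring_scope.

Section Processes.
Context {d : measure_display} {Omega : measurableType d} {R : realType}.
Variable P : probability Omega R.

(* The product rule over all Borel sets is enough for mutual independence:
   subfamilies are obtained by taking some of the A i equal to setT. *)
Definition mutually_independent n (Y : 'I_n -> Omega -> R) :=
  forall A : 'I_n -> set R, (forall i, measurable (A i)) ->
    P (\bigcap_(i in [set: 'I_n]) (Y i @^-1` A i)) =
    (\prod_(i < n) P (Y i @^-1` A i))%E.

(* Processes are indexed by R, but only the times t >= 0 are ever used. *)
Definition independent_increments (X : R -> Omega -> R) :=
  forall n (t : nat -> R), 0 <= t 0 -> (forall i, t i <= t i.+1) ->
    mutually_independent (fun (i : 'I_n) w => X (t i.+1) w - X (t i) w).

Definition stationary_increments (X : R -> Omega -> R) :=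
  forall s t : R, 0 <= s -> s <= t -> forall A : set R, measurable A ->
    P [set w | A (X t w - X s w)] = P [set w | A (X (t - s) w - X 0 w)].

Definition cadlag (x : R -> R) :=
  (forall t, 0 <= t -> x s @[s --> t^'+] --> x t) /\
  (forall t, 0 < t -> cvg (x s @[s --> t^'-])).

Definition levy_process (X : R -> {RV P >-> R}) :=
  [/\ independent_increments X,
      stationary_increments X &
      {ae P, forall w, cadlag (fun t => X t w)}].

Definition cvg_in_prob (Y : R -> Omega -> R) (c : R) :=
  forall eps : R, 0 < eps ->
    P [set w | eps < `|Y t w - c|] @[t --> 0^'+] --> 0%E.

(* As r -> 0+, the variables Y r converge in probability to c, where Y r is
   only meaningful on the event D r: the probability of D r tends to 1 and on
   D r the deviations of Y r from c tend to 0 in probability. The outer measure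
   mu_ext P equals P on measurable sets. It is used because a process stopped
   at a passage time need not be measurable when its paths are cadlag only
   almost surely and P is not complete, nor B (T r) when B is not measurable
   away from 0; P has no meaning on nonmeasurable sets. *)
Definition cvg_in_prob_on (D : R -> set Omega) (Y : R -> Omega -> R) (c : R) :=
  mu_ext P (~` D r) @[r --> 0^'+] --> 0%E /\
  forall eps : R, 0 < eps ->
    mu_ext P (D r `&` [set w | eps < `|Y r w - c|]) @[r --> 0^'+] --> 0%E.

End Processes.

Section PassageTimes.
Context {Omega : Type} {R : realType}.
Variable X : R -> Omega -> R.

(* ereal_inf set0 = +oo and 0 `^ 0 = 1. *)
Definition Tbar (b r : R) (w : Omega) : \bar R :=
  ereal_inf [set t%:E | t in [set t : R | 0 <= t /\ r * t `^ b < X t w]].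

Definition Tstar (b r : R) (w : Omega) : \bar R :=
  ereal_inf [set t%:E | t in [set t : R | 0 <= t /\ r * t `^ b < `|X t w|]].

End PassageTimes.

(* Main.v *)
(* Increments over [s, s+t] are distributed as X_t, so X_t / B t -> 1 forces
   B (s + t) ~ B s + B t. Hence B is nearly linear on [0, 2t] for small t,
   B (t / 2) <= rho B t with rho 2^b < 1, and B t / t^b decreases to 0 with t, so
   every small r is B t / t^b with t = C r. Ottaviani's inequality upgrades the
   convergence at fixed times to X_s ~ (s / t) B t uniformly on [0, 2t]. In units
   of t and B t, the path is thus close to the line s while the boundary is s^b,
   and the first crossing is near s = 1 unless it is near s = 0.
   Near 0, let q = P(|X_u| > 3 B(2^i u)). The 2^i increments of length u before
   2^i u are all at most 3 B(2^i u) with probability (1 - q)^(2^i), which is near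
   1 by the uniform estimate at scale 2^i u; so q is a small multiple of 2^-i. At
   the scales u = 2^(-(m+1)i) t these probabilities are summable over i, and
   B(2^i u) is below the boundary once m and i are large.
   For |X|, opposite signs of X_t and X_2t - X_t would make |X_2t| too small, and
   a change of sign between s and t <= 2s would make X_t - X_s too large, so X or
   -X satisfies the hypothesis on X. *)
Require Import Defs.
From mathcomp Require Import ring lra.

Set Implicit Arguments.
Unset Strict Implicit.
Unset Printing Implicit Defensive.

Local Open Scope classical_set_scope.
Local Open Scope ring_scope.

(** * Deviation events and real-valued probabilities *)

Lemma measurable_dist_gt {d : measure_display} {T : measurableType d}
    {R : realType} (f : T -> R) (x m : R) :
  measurable_fun setT f -> measurable [set w | x < `|f w - m|].
Proof.
move=> mf.
have mg : measurable_fun setT (fun w => `|f w - m|).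
  apply: measurableT_comp; first exact: measurable_realfun.normr_measurable.
  by apply: measurable_realfun.measurable_funB; last exact: measurable_cst.
have := mg measurableT `]x, +oo[%classic (measurable_itv _).
rewrite setTI; congr (measurable _).
by apply/seteqP; split => w /=; rewrite in_itv/= andbT.
Qed.

Section Probability.
Context {d : measure_display} {Omega : measurableType d} {R : realType}.
Variable P : probability Omega R.
Implicit Types A B : set Omega.

Definition pr A : R := fine (P A).

Lemma prE A : measurable A -> P A = (pr A)%:E.
Proof. by move=> mA; rewrite /pr fineK// fin_num_measure. Qed.

Lemma pr_ge0 A : 0 <= pr A.
Proof. by rewrite fine_ge0. Qed.

Lemma pr_le1 A : measurable A -> pr A <= 1.
Proof. by move=> mA; rewrite -lee_fin -prE// probability_le1. Qed.

Lemma prT : pr setT = 1.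
Proof. by rewrite /pr probability_setT. Qed.

Lemma pr0 : pr set0 = 0.
Proof. by rewrite /pr measure0. Qed.

Lemma le_pr A B : measurable A -> measurable B -> A `<=` B -> pr A <= pr B.
Proof.
by move=> mA mB AB; rewrite -lee_fin -!prE// le_measure ?inE.
Qed.

Lemma prC A : measurable A -> pr (~` A) = 1 - pr A.
Proof.
move=> mA; apply: EFin_inj.
by rewrite -prE ?probability_setC// 1?prE//; exact: measurableC.
Qed.

Lemma prU A B : measurable A -> measurable B -> pr (A `|` B) <= pr A + pr B.
Proof.
move=> mA mB; rewrite -lee_fin EFinD -!prE//; last exact: measurableU.
exact: measureU2.
Qed.

Lemma prU3 A B C : measurable A -> measurable B -> measurable C ->
  pr (A `|` B `|` C) <= pr A + pr B + pr C.
Proof.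
move=> mA mB mC; apply: (le_trans (prU _ mC)); first exact: measurableU.
by rewrite lerD2r prU.
Qed.

(** Deterministic inequalities about [B] are extracted this way: bad events of total probability
    below 1 leave a sample point outside all of them. *)
Lemma pr_lt1_ex A : measurable A -> pr A < 1 -> exists w, ~ A w.
Proof.
move=> mA A1; apply: contrapT => /forallNP nA; move: A1.
suff -> : A = setT by rewrite prT ltxx.
by apply/seteqP; split => // w _; exact: contrapT.
Qed.

Lemma le_pr_bigcup (F : nat -> set Omega) (x : R) :
  (forall n, measurable (F n)) -> nondecreasing_seq F ->
  (forall n, pr (F n) <= x) -> pr (\bigcup_n F n) <= x.
Proof.
move=> mF ndF Fx.
have mU : measurable (\bigcup_n F n) by exact: bigcup_measurable.
rewrite -lee_fin -prE//; have cv := nondecreasing_cvg_mu (mu := P) mF mU ndF.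
apply: (cvge_to_le cv).
by apply: nearW => n /=; rewrite prE// lee_fin.
Qed.

Lemma pr_bigcup_mkord (F : nat -> set Omega) n :
  (forall k, measurable (F k)) -> trivIset setT F ->
  pr (\bigcup_(k in `I_n) F k) = \sum_(k < n) pr (F k).
Proof.
move=> mF tF; apply: EFin_inj; rewrite -sumEFin -prE; last first.
  by apply: fin_bigcup_measurable => //; exact: finite_II.
rewrite bigcup_mkord measure_bigsetU//.
by apply: eq_bigr => k _; exact: prE.
Qed.

(** * Independence of an increment from the past *)

Section Independence.
Variable Y : R -> Omega -> R.
Hypothesis mY : forall t, measurable_fun setT (Y t).
Hypothesis indY : independent_increments P Y.
Variable t : nat -> R.
Hypothesis t_ge0 : 0 <= t 0.
Hypothesis t_nd : forall i, t i <= t i.+1.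

Let D i w := Y (t i.+1) w - Y (t i) w.

Let mD i : measurable_fun setT (D i).
Proof. exact: measurable_realfun.measurable_funB. Qed.

Let mDV i (A : set R) : measurable A -> measurable (D i @^-1` A).
Proof. by move=> mA; rewrite -[X in measurable X]setTI; exact: mD. Qed.

Lemma indep_increments_nat n (A : nat -> set R) :
  (forall i, measurable (A i)) ->
  P (\bigcap_(i in `I_n) (D i @^-1` A i)) = (\prod_(i < n) P (D i @^-1` A i))%E.
Proof.
move=> mA; rewrite -(indY t_ge0 t_nd (A := fun i : 'I_n => A i))//.
congr (P _); apply/seteqP; split => w /= h.
  by move=> i _; apply: h => /=.
by move=> i /= ni; exact: (h (Ordinal ni)).
Qed.

(** A pi-system generating the sigma-algebra of the first [n] increments. *)
Let rects n : set (set Omega) := [set E | exists2 A : nat -> set R,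
  (forall i, measurable (A i)) & E = \bigcap_(i in `I_n) (D i @^-1` A i)].

Let rectsI n : setI_closed (rects n).
Proof.
move=> _ _ [A mA ->] [B mB ->]; exists (fun i => A i `&` B i).
  by move=> i; exact: measurableI.
apply/seteqP; split => w /=.
  by move=> [h1 h2] i ni; split; [exact: h1|exact: h2].
by move=> h; split => i /h [].
Qed.

Let mrects n E : rects n E -> measurable E.
Proof.
move=> [A mA ->]; apply: fin_bigcap_measurable; first exact: finite_II.
by move=> i _; exact: mDV.
Qed.

(** Dynkin's argument: the events obeying the product rule with the increment of index [n] form a
    lambda-system, and this system contains the pi-system [rects n]. *)
Lemma sigma_rects_indep n E (A : set R) : <<s rects n >> E -> measurable A ->
  measurable E /\ P (E `&` D n @^-1` A) = (P E * P (D n @^-1` A))%E.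
Proof.
move=> sE mA.
suff : <<s rects n >> `<=` [set E | measurable E /\
    P (E `&` D n @^-1` A) = (P E * P (D n @^-1` A))%E] by exact.
have mF : measurable (D n @^-1` A) by exact: mDV.
apply: (lambda_system_subset (@rectsI n)) => //.
  apply/dynkin_lambda_system; split.
  - by split => //; rewrite setTI probability_setT mul1e.
  - move=> B [mB PB]; split; first exact: measurableC.
    have mBF : measurable (B `&` D n @^-1` A) by exact: measurableI.
    have : P (D n @^-1` A) = (P (D n @^-1` A `\` B) + P (D n @^-1` A `&` B))%E.
      exact: measureDI.
    have -> : D n @^-1` A `\` B = ~` B `&` D n @^-1` A by rewrite setIC setDE.
    rewrite (setIC (D n @^-1` A) B) PB probability_setC//.
    have mCF : measurable (~` B `&` D n @^-1` A).
      by apply: measurableI => //; exact: measurableC.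
    rewrite !prE// -EFinB -!EFinM -EFinD => -[h].
    by congr EFin; lra.
  - move=> F tF h; split.
      by apply: bigcup_measurable => k _; exact: (h k).1.
    rewrite setI_bigcupl !measure_bigcup//.
    + rewrite (prE mF) muleC -nneseriesZl//.
      by apply: eq_eseriesr => k _; rewrite muleC -prE//; exact: (h k).2.
    + by move=> k _; exact: (h k).1.
    + by move=> k _; apply: measurableI => //; exact: (h k).1.
    + exact: trivIset_setIr.
move=> E' rE; split; first exact: mrects rE.
case: rE => B mB ->.
(* With [A] as the factor of index [n], the intersection becomes a rectangle in [n.+1] increments,
   to which the product rule applies directly. *)
pose B' i := if i == n then A else B i.
have mB' i : measurable (B' i) by rewrite /B'; case: ifP.
have := @indep_increments_nat n.+1 B' mB'.
have B'n : B' n = A by rewrite /B' eqxx.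
rewrite big_ord_recr/= B'n.
have -> : \bigcap_(i in `I_n.+1) (D i @^-1` B' i) =
  \bigcap_(i in `I_n) (D i @^-1` B i) `&` D n @^-1` A.
  apply/seteqP; split => w /=.
    move=> h; split; last by rewrite -B'n; exact: (h n (ltnSn n)).
    by move=> i /= ni; have := h i (ltnW ni); rewrite /B' (ltn_eqF ni).
  move=> [h1 h2] i /=; rewrite ltnS leq_eqVlt => /orP[/eqP ->|ni].
    by rewrite /= B'n.
  by rewrite /B' (ltn_eqF ni); exact: h1.
move=> ->; congr (_ * _)%E; rewrite indep_increments_nat//.
by apply: eq_bigr => i _; rewrite /B' (ltn_eqF (ltn_ord i)).
Qed.

(** Telescoping: the displacement is the sum of the first [j] increments. *)
Let past_measurable n j : (j <= n)%N ->
  measurable_fun [set: g_sigma_algebraType (rects n)]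
    (fun w => Y (t j) w - Y (t 0) w).
Proof.
elim: j => [_|j IH jn].
  by rewrite (_ : (fun _ => _) = cst 0)//; apply/funext => w; rewrite subrr.
rewrite (_ : (fun _ => _) = (fun w => (Y (t j) w - Y (t 0) w) + D j w)).
  apply: measurable_realfun.measurable_funD; first by apply: IH; exact: ltnW.
  move=> _ V mV; rewrite setTI; apply: sub_sigma_algebra.
  exists (fun i => if i == j then V else setT).
    by move=> i; case: ifP.
  apply/seteqP; split => w /=.
    by move=> Vw i /= _; case: eqP => [->|].
  by move=> /(_ j jn) /=; rewrite eqxx.
by apply/funext => w; rewrite /D; ring.
Qed.

(** First-passage event of the walk with drift [c] removed. These events are disjoint in [n], and
    each is determined by the first [n] increments. *)
Definition passage_at (c x : R) n : set Omega :=
  [set w | x < `|(Y (t n) w - Y (t 0) w) - c * (t n - t 0)|] `&`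
  \bigcap_(j in `I_n)
    [set w | `|(Y (t j) w - Y (t 0) w) - c * (t j - t 0)| <= x].

Lemma passage_at_indep (c x : R) n (V : set R) : measurable V ->
  measurable (passage_at c x n) /\
  pr (passage_at c x n `&` (fun w => Y (t n.+1) w - Y (t n) w) @^-1` V) =
  pr (passage_at c x n) * pr ((fun w => Y (t n.+1) w - Y (t n) w) @^-1` V).
Proof.
move=> mV.
have mZ j : (j <= n)%N -> measurable_fun [set: g_sigma_algebraType (rects n)]
    (fun w => `|(Y (t j) w - Y (t 0) w) - c * (t j - t 0)|).
  move=> jn; apply: measurableT_comp.
    exact: measurable_realfun.normr_measurable.
  apply: measurable_realfun.measurable_funB; first exact: past_measurable.
  exact: measurable_cst.
have sA : <<s rects n >> (passage_at c x n).
  rewrite -[<<s _ >> _]/(measurable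
    (passage_at c x n : set (g_sigma_algebraType (rects n)))).
  apply: measurableI.
    have := mZ _ (leqnn n) measurableT `]x, +oo[%classic (measurable_itv _).
    rewrite setTI; congr (measurable _).
    by apply/seteqP; split => w /=; rewrite in_itv/= andbT.
  apply: fin_bigcap_measurable; first exact: finite_II.
  move=> j /= jn.
  have := mZ _ (ltnW jn) measurableT `]-oo, x]%classic (measurable_itv _).
  by rewrite setTI; congr (measurable _).
have [mA PA] := sigma_rects_indep sA mV; split => //.
apply: EFin_inj; rewrite EFinM -!prE//; first exact: mDV.
by apply: measurableI => //; exact: mDV.
Qed.

End Independence.

(** * Ottaviani's inequality on a finite grid *)

Section Maximal.
Variable Y : R -> Omega -> R.
Hypothesis mY : forall t, measurable_fun setT (Y t).
Hypothesis indY : independent_increments P Y.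

Lemma measurable_dev_gt s t (x m : R) :
  measurable [set w | x < `|Y t w - Y s w - m|].
Proof.
by apply: measurable_dist_gt; exact: measurable_realfun.measurable_funB.
Qed.

(** At the first index [k] where the deviation exceeds [2a], the remaining deviation is independent
    of the past and at most [a] with probability at least 1/2; when both occur, the final deviation
    exceeds [a]. Summing over the disjoint first-passage events gives the factor 2. *)
Lemma ottaviani (t : nat -> R) (c a : R) n :
  0 <= t 0 -> (forall i, t i <= t i.+1) ->
  (forall k, (k <= n)%N ->
     pr [set w | a < `|Y (t n) w - Y (t k) w - c * (t n - t k)|] <= 2^-1) ->
  pr (\bigcup_(k in `I_n.+1)
        [set w | a + a < `|Y (t k) w - Y (t 0) w - c * (t k - t 0)|]) <=
  2 * pr [set w | a < `|Y (t n) w - Y (t 0) w - c * (t n - t 0)|].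
Proof.
move=> t0 tnd half.
have tle i j : (i <= j)%N -> t i <= t j.
  by move/nondecreasing_seqP: tnd => tnd ij; exact: tnd.
set E := fun k => [set w | a + a < `|Y (t k) w - Y (t 0) w - c * (t k - t 0)|].
set L := [set w | a < `|Y (t n) w - Y (t 0) w - c * (t n - t 0)|].
pose A k := passage_at Y t c (a + a) k.
pose H k := [set w | `|Y (t n) w - Y (t k) w - c * (t n - t k)| <= a].
have mL : measurable L by exact: measurable_dev_gt.
have mE k : measurable (E k) by exact: measurable_dev_gt.
have HC k : H k = ~` [set w | a < `|Y (t n) w - Y (t k) w - c * (t n - t k)|].
  rewrite /H; apply/seteqP; split => w /=; first by rewrite leNgt => /negP.
  by move=> /negP; rewrite -leNgt.
have mH k : measurable (H k).
  by rewrite HC; apply: measurableC; exact: measurable_dev_gt.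
have AH k : (k <= n)%N ->
    measurable (A k) /\ pr (A k `&` H k) = pr (A k) * pr (H k).
  (* [u] follows [t] up to index [k] and then jumps to [t n], so that the whole remaining stretch is
     the single increment of index [k]. *)
  move=> kn; pose u i := if (i <= k)%N then t i else t n.
  have u0 : 0 <= u 0 by [].
  have und i : u i <= u i.+1.
    rewrite /u; case: (ltnP i k) => ik; first by rewrite (ltnW ik).
    by case: ifP => // ik'; apply: tle; exact: leq_trans ik' kn.
  pose V := [set x : R | `|x - c * (t n - t k)| <= a].
  have mV : measurable V.
    rewrite (_ : V = `[c * (t n - t k) - a, c * (t n - t k) + a]%classic)//.
    by rewrite /V; apply/seteqP; split => x /=; rewrite in_itv/= ler_distl.
  have Au : passage_at Y u c (a + a) k = A k.
    rewrite /A /passage_at /u leqnn leq0n; congr (_ `&` _).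
    by apply: eq_bigcapr => j /= jk; rewrite (ltnW jk).
  have [mA] := @passage_at_indep Y mY indY u u0 und c (a + a) k V mV.
  have uS : u k.+1 = t n by rewrite /u ltnn.
  have uk : u k = t k by rewrite /u leqnn.
  by rewrite Au uS uk in mA *; split.
have mA k : measurable (A k).
  by have [] :=
    @passage_at_indep Y mY indY t t0 tnd c (a + a) k setT measurableT.
(* An exceedance has a first index, found by strong induction; this replaces the union by a disjoint
   one. *)
have UE : \bigcup_(k in `I_n.+1) E k = \bigcup_(k in `I_n.+1) A k.
  apply/seteqP; split => w [k /= kn]; last by case=> Ek _; exists k.
  elim/ltn_ind: k kn => k IH kn Ek.
  have [[j /= jk Ej]|/forall2NP nE] := pselect (exists2 j, (j < k)%N & E j w).
    by apply: (IH j) => //; exact: ltn_trans kn.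
  exists k => //; split => // j /= jk.
  by case: (nE j) => // /negP; rewrite -leNgt.
have tA : trivIset setT A.
  move=> i j _ _ [w [[Ei Fi] [Ej Fj]]].
  have [ij|ji|//] := ltngtP i j.
    by move: Ei; rewrite /= ltNge (Fj i ij).
  by move: Ej; rewrite /= ltNge (Fi j ji).
rewrite UE pr_bigcup_mkord//.
apply: (@le_trans _ _ (2 * \sum_(k < n.+1) pr (A k `&` H k))).
  rewrite mulr_sumr; apply: ler_sum => -[k /= kn] _.
  have [_ ->] := AH k kn; rewrite mulrCA ler_peMr ?pr_ge0//.
  rewrite HC prC; last exact: measurable_dev_gt.
  by have := half k kn; lra.
rewrite ler_pM2l// -(@pr_bigcup_mkord (fun k => A k `&` H k)); last 2 first.
- by move=> k; exact: measurableI.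
- exact: trivIset_setIr.
apply: le_pr => //.
  apply: fin_bigcup_measurable; first exact: finite_II.
  by move=> k _; exact: measurableI.
move=> w [k /= kn [[Ek _] Hk]]; move: Ek Hk; rewrite /H /L /=.
set x := _ - _ - _; set y := _ - _ - _.
have -> : Y (t n) w - Y (t 0) w - c * (t n - t 0) = x + y.
  by rewrite /x /y; ring.
by have := ler_normB (x + y) y; rewrite addrK; lra.
Qed.

End Maximal.
End Probability.

(** * Dyadic approximation and geometric decay *)

Section RealLemmas.
Context {R : realType}.

Lemma near_right_ex (x : R) (Q : R -> Prop) :
  (\forall u \near x^'+, Q u) <->
  exists2 e, 0 < e & forall u, x < u < x + e -> Q u.
Proof.
split.
  rewrite /at_right /within /= => /nbhs_ballP[e /= e0 h].
  exists e => // u /andP[xu ue].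
  by apply: h => //; rewrite /ball/= ltr_norml; apply/andP; split; lra.
move=> [e e0 h]; near=> u; apply: h; apply/andP; split.
  by near: u; exact: nbhs_right_gt.
by near: u; apply: nbhs_right_lt; lra.
Unshelve. all: by end_near. Qed.

Lemma exp_half_lt (e x : R) : 0 < e -> exists m, x / 2 ^+ m < e.
Proof.
move=> e0; exists (Num.truncn (x / e)).+1.
rewrite ltr_pdivrMr ?exprn_gt0// mulrC -ltr_pdivrMr//.
apply: (lt_trans (truncnS_gt _)).
by rewrite -natrX ltr_nat ltn_expl.
Qed.

(** Once the mesh [tau / 2^m] is below both [e] and [tau - s], the first grid point beyond [s]
    works. *)
Lemma dyadic_between (s tau e : R) : 0 <= s -> s < tau -> 0 < e ->
  exists m k, [/\ (k <= 2 ^ m)%N, s < tau * (k%:R / 2 ^+ m) &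
                  tau * (k%:R / 2 ^+ m) < s + e].
Proof.
move=> s0 st e0; have t0 : 0 < tau by lra.
have e'0 : 0 < Num.min e (tau - s) by rewrite lt_min e0 subr_gt0.
have [m] := exp_half_lt tau e'0; rewrite lt_min => /andP[m1 m2].
have p0 : 0 < (2 : R) ^+ m by rewrite exprn_gt0.
pose x := s * 2 ^+ m / tau.
have x0 : 0 <= x by rewrite divr_ge0// ?mulr_ge0// ltW.
exists m, (Num.truncn x).+1.
have kx : (Num.truncn x).+1%:R <= x + 1 by rewrite -natr1 lerD2r truncn_le.
have xk := truncnS_gt x.
have tE (y : R) : tau * (y / 2 ^+ m) = y * (tau / 2 ^+ m) by rewrite mulrCA.
have xE : x * (tau / 2 ^+ m) = s.
  by rewrite /x; field; rewrite !gt_eqF.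
have q0 : 0 < tau / 2 ^+ m by rewrite divr_gt0.
have h1 : s < tau * ((Num.truncn x).+1%:R / 2 ^+ m).
  by rewrite tE -[ltLHS]xE ltr_pM2r.
have h2 : tau * ((Num.truncn x).+1%:R / 2 ^+ m) <= s + tau / 2 ^+ m.
  by rewrite tE -[X in _ <= X + _]xE -[X in _ <= _ + X]mul1r -mulrDl ler_pM2r.
split => //; last by lra.
rewrite -(ler_nat R) natrX -(ler_pM2r q0) -tE.
by rewrite [leRHS](_ : _ = tau); [lra|field; rewrite gt_eqF].
Qed.

Lemma exp_lt_ex (x e : R) : 0 <= x -> x < 1 -> 0 < e -> exists n, x ^+ n < e.
Proof.
move=> x0 x1 e0; have x1' : `|x| < 1 by rewrite ger0_norm.
have [n _ h] := cvgr_lt _ (cvg_expr x1') _ e0.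
by exists n; exact: (h n (leqnn n)).
Qed.

Lemma powR_expV (b : R) k : ((2 ^+ k)^-1 : R) `^ b = ((2 `^ b) ^+ k)^-1.
Proof.
have two0 : 0 <= 2 :> R by [].
by rewrite -(powR_invn k two0) powRAC powR_invn ?powR_ge0.
Qed.

(** The least [n] with [t / 2^((p+1) n) < s] exceeds [i0]; [i] is its predecessor. *)
Lemma halving_bracket (s t : R) i0 p :
  0 < s -> 0 < t -> s <= t / 2 ^+ (p.+1 * i0) ->
  exists i, [/\ (i0 <= i)%N, t / 2 ^+ (p.+1 * i.+1) < s &
    s <= t / 2 ^+ (p.+1 * i)].
Proof.
move=> s0 t0 si0.
have ex : exists n, t / 2 ^+ (p.+1 * n) < s.
  have [n hn] := exp_half_lt t s0; exists n; apply: le_lt_trans hn.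
  rewrite ler_pM2l// lef_pV2 ?posrE ?exprn_gt0//.
  by rewrite ler_eXn2l ?ltr1n// leq_pmull.
have [n hn nmin] := ex_minnP ex.
have n0 : (i0 < n)%N.
  rewrite ltnNge; apply/negP => ni; move: hn; rewrite ltNge => /negP; apply.
  apply: (le_trans si0); rewrite ler_pM2l// lef_pV2 ?posrE ?exprn_gt0//.
  by rewrite ler_eXn2l ?ltr1n// leq_pmul2l.
case: n n0 hn nmin => // n n0 hn nmin; exists n; split => //.
by rewrite leNgt; apply/negP => /nmin; rewrite ltnn.
Qed.

End RealLemmas.

(** * Maximal inequality in continuous time *)

Section Maximal.
Context {d : measure_display} {Omega : measurableType d} {R : realType}.
Variable P : probability Omega R.

(** Right-continuity is what carries a bound from dyadic times to all times. *)
Definition good_path (y : R -> R) :=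
  y 0 = 0 /\ forall t, 0 <= t -> y s @[s --> t^'+] --> y t.

(** The almost sure conditions are gathered in one measurable null set [N]. Being stated for plain
    functions, the predicate applies to [-X] as well as to [X]. *)
Definition levy_from0 (Y : R -> Omega -> R) :=
  [/\ forall t, measurable_fun setT (Y t), independent_increments P Y,
      stationary_increments P Y & exists N,
      [/\ measurable N, pr P N = 0 & forall w, ~ N w -> good_path (Y ^~ w)]].

(** Ottaviani's inequality holds on every dyadic grid of [[0, tau]] with a bound free of the mesh.
    The exceedance events increase with the level, so the bound passes to their union, and
    right-continuity extends the estimate to all times. *)
Lemma maximal_ineq (Y : R -> Omega -> R) (c a tau : R) :
  levy_from0 Y -> 0 < tau ->
  (forall s, 0 <= s -> s <= tau ->
     pr P [set w | a < `|Y tau w - Y s w - c * (tau - s)|] <= 2^-1) ->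
  exists G, [/\ measurable G,
    pr P (~` G) <= 2 * pr P [set w | a < `|Y tau w - Y 0 w - c * (tau - 0)|] &
    forall w, G w -> good_path (Y ^~ w) /\
      forall s, 0 <= s -> s <= tau -> `|Y s w - c * s| <= a + a].
Proof.
move=> [mY indY statY [N [mN PN gN]]] tau0 half.
pose t m k : R := tau * (k%:R / 2 ^+ m).
have t0 m : t m 0 = 0 by rewrite /t mul0r mulr0.
have tn m : t m (2 ^ m)%N = tau by rewrite /t natrX divff ?mulr1// expf_neq0.
have p0 m : 0 < (2 : R) ^+ m by rewrite exprn_gt0.
have tnd m i : t m i <= t m i.+1.
  by rewrite /t ler_pM2l// ler_pM2r ?invr_gt0// ler_nat.
have t_ge0 m i : 0 <= t m i.
  rewrite /t; apply: mulr_ge0; first exact: ltW.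
  by apply: divr_ge0 => //; exact: ltW.
have t_le m i : (i <= 2 ^ m)%N -> t m i <= tau.
  move=> im; rewrite -[leRHS](tn m) /t ler_pM2l// ler_pM2r ?invr_gt0//.
  by rewrite ler_nat.
pose E m := \bigcup_(k in `I_(2 ^ m).+1)
  [set w | a + a < `|Y (t m k) w - Y 0 w - c * (t m k - 0)|].
have mE m : measurable (E m).
  apply: fin_bigcup_measurable; first exact: finite_II.
  by move=> k _; exact: measurable_dev_gt.
have PE m : pr P (E m) <=
    2 * pr P [set w | a < `|Y tau w - Y 0 w - c * (tau - 0)|].
  have := @ottaviani _ _ _ P Y mY indY (t m) c a (2 ^ m)%N.
  rewrite t0 tn; apply => // k kn; apply: half => //; exact: t_le.
(* The grids are nested: index [k] at level [m] is index [2k] at level [m+1]. *)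
have ndE : nondecreasing_seq E.
  apply/nondecreasing_seqP => m; apply/subsetPset => w [k /= km Ek].
  exists (2 * k)%N.
    by rewrite /= expnS; move: km; rewrite !ltnS leq_mul2l.
  have -> : t m.+1 (2 * k)%N = t m k.
    by rewrite /t exprS natrM -mulf_div divff// mul1r.
  exact: Ek.
have mU : measurable (\bigcup_m E m) by exact: bigcup_measurable.
exists (~` (\bigcup_m E m `|` N)); split.
- by apply: measurableC; exact: measurableU.
- rewrite setCK; apply: (le_trans (prU _ mU mN)); rewrite PN addr0.
  exact: le_pr_bigcup.
- move=> w /not_orP[nE nN]; have [Y0 rc] := gN w nN; split; first exact: gN.
  have dy m k : (k <= 2 ^ m)%N -> `|Y (t m k) w - c * t m k| <= a + a.
    move=> km; rewrite leNgt; apply/negP => h.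
    apply: nE; exists m => //; exists k => //=.
    by rewrite Y0 !subr0.
  move=> s s0; rewrite le_eqVlt => /orP[/eqP ->|st].
    by rewrite -(tn 0%N); exact: dy.
  (* A violation at [s] persists just to the right of [s], where there is a dyadic time. *)
  rewrite leNgt; apply/negP => h.
  have cv : `|Y u w - c * u| @[u --> s^'+] --> `|Y s w - c * s|.
    apply: cvg_norm; apply: cvgB; first exact: rc.
    apply: cvgM; first exact: cvg_cst.
    exact/cvg_at_right_filter/cvg_id.
  have : \forall u \near s^'+, a + a < `|Y u w - c * u|.
    exact: (cvgr_gt _ cv).
  move=> /near_right_ex[e e0 he].
  have [m [k [km k1 k2]]] := dyadic_between s0 st e0.
  have := he (t m k); rewrite k1 k2 => /(_ isT).
  by rewrite ltNge dy.
Qed.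

End Maximal.

(** * Stationarity for a process started at zero *)

Section Levy.
Context {d : measure_display} {Omega : measurableType d} {R : realType}.
Variable P : probability Omega R.
Variable Y : R -> Omega -> R.
Hypothesis LY : levy_from0 P Y.

Let mY t : measurable_fun setT (Y t). Proof. by case: LY. Qed.

Lemma pr_eq_off (N A B : set Omega) : measurable N -> measurable A ->
  measurable B -> pr P N = 0 -> (forall w, ~ N w -> A w <-> B w) ->
  pr P A = pr P B.
Proof.
move=> mN mA mB PN AB; apply/eqP; rewrite eq_le; apply/andP; split.
  rewrite -[leRHS]addr0 -PN; apply: le_trans (prU _ mB mN).
  apply: le_pr => //; first exact: measurableU.
  by move=> w Aw; have [|nN] := pselect (N w); [right|left; apply/AB].
rewrite -[leRHS]addr0 -PN; apply: le_trans (prU _ mA mN).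
apply: le_pr => //; first exact: measurableU.
by move=> w Aw; have [|nN] := pselect (N w); [right|left; apply/AB].
Qed.

Lemma measurable_dev0_gt t (x m : R) : measurable [set w | x < `|Y t w - m|].
Proof. exact: measurable_dist_gt. Qed.

(** Stationarity gives the law of [Y (t - s) - Y 0]; since [Y 0] vanishes only almost surely, it is
    removed off the null set. *)
Lemma pr_incr_dev s t (x m : R) : 0 <= s -> s <= t ->
  pr P [set w | x < `|Y t w - Y s w - m|] =
  pr P [set w | x < `|Y (t - s) w - m|].
Proof.
move=> s0 st; have [_ _ statY [N [mN PN gN]]] := LY.
have mV : measurable [set y : R | x < `|y - m|].
  by apply: (measurable_dist_gt (f := id)).
have := statY s t s0 st _ mV; rewrite /= /pr => ->.
rewrite -/(pr P _) -/(pr P _).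
apply: (pr_eq_off mN) => //.
- exact: measurable_dev_gt.
- exact: measurable_dev0_gt.
- by move=> w /gN[/= Y0 _]; rewrite /= Y0 subr0.
Qed.

End Levy.

(** * Regularity of [B] and path estimates at each scale *)

Section Scales.
Context {d : measure_display} {Omega : measurableType d} {R : realType}.
Variable P : probability Omega R.
Variable Y : R -> Omega -> R.
Variables (B : R -> R) (b delta : R).
Hypothesis LY : levy_from0 P Y.
Hypothesis b_ge0 : 0 <= b.
Hypothesis b_lt1 : b < 1.
Hypothesis B_gt0 : forall t : R, 0 < t < delta -> 0 < B t.
Hypothesis B_incr : forall s t : R, 0 < s -> s < t -> t < delta ->
     B s / s `^ b < B t / t `^ b.

(** [B] is the product of [B t / t^b] and [t^b], both positive and nondecreasing. *)
Lemma B_le (s t : R) : 0 < s -> s <= t -> t < delta -> B s <= B t.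
Proof.
move=> s0; rewrite le_eqVlt => /orP[/eqP ->//|st] td.
have t0 : 0 < t by exact: lt_trans st.
have sb : 0 < s `^ b by exact: powR_gt0.
have tb : 0 < t `^ b by exact: powR_gt0.
rewrite -(divfK (lt0r_neq0 sb) (B s)) -(divfK (lt0r_neq0 tb) (B t)).
apply: ler_pM.
- by rewrite divr_ge0 ?ltW// B_gt0 ?s0 ?(lt_trans st).
- exact: ltW.
- exact/ltW/B_incr.
- by apply: ge0_ler_powR => //; rewrite ?nnegrE ltW.
Qed.

Hypothesis conv : forall e h : R, 0 < e -> 0 < h -> exists2 t0,
  0 < t0 < delta & forall t : R, 0 < t < t0 ->
    pr P [set w | e * B t < `|Y t w - B t|] <= h.

Let mY t : measurable_fun setT (Y t). Proof. by case: LY. Qed.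

(** Where [Y s], [Y (s + t) - Y s] and [Y (s + t)] are all close to the corresponding values of [B],
    the additivity of the increments passes to [B]. Three exceptional events of probability at most
    1/4 each leave such a sample point. *)
Lemma B_add (e : R) : 0 < e -> exists2 t0, 0 < t0 < delta &
  forall s t : R, 0 < s -> 0 < t -> s + t < t0 ->
  `|B (s + t) - B s - B t| <= e * B (s + t).
Proof.
move=> e0; have e30 : 0 < e / 3 by lra.
have h0 : 0 < (4^-1 : R) by lra.
have [t0 /andP[t00 t0d] ht] := conv e30 h0; exists t0; first by rewrite t00.
move=> s t s0 t_0 st.
have mA1 := measurable_dev0_gt LY s (e / 3 * B s) (B s).
have mA2 := measurable_dev_gt mY s (s + t) (e / 3 * B t) (B t).
have mA3 := measurable_dev0_gt LY (s + t) (e / 3 * B (s + t)) (B (s + t)).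
have mA12 := measurableU _ _ mA1 mA2.
have : pr P ([set w | e / 3 * B s < `|Y s w - B s|] `|`
   [set w | e / 3 * B t < `|Y (s + t) w - Y s w - B t|] `|`
   [set w | e / 3 * B (s + t) < `|Y (s + t) w - B (s + t)|]) < 1.
  apply: (le_lt_trans (prU3 _ mA1 mA2 mA3)).
  rewrite (pr_incr_dev LY) ?ltW//; last by lra.
  have -> : s + t - s = t by ring.
  have := ht s; have := ht t; have := ht (s + t).
  rewrite s0 t_0 st addr_gt0//= => /(_ isT) h1.
  have -> : t < t0 by lra.
  have -> : s < t0 by lra.
  by move=> /(_ isT) h2 /(_ isT) h3; lra.
move=> /(pr_lt1_ex (measurableU _ _ mA12 mA3))[w] /not_orP[/not_orP[]] /=.
move=> /negP + /negP + /negP; rewrite -!leNgt.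
have Bs : B s <= B (s + t) by apply: B_le => //; lra.
have Bt : B t <= B (s + t) by apply: B_le => //; lra.
move: Bs Bt; rewrite !ler_norml => Bs Bt /andP[a1 a2] /andP[b1 b2] /andP[c1 c2].
have : e / 3 * B s <= e / 3 * B (s + t) by rewrite ler_pM2l.
have : e / 3 * B t <= e / 3 * B (s + t) by rewrite ler_pM2l.
by move=> ? ?; apply/andP; split; lra.
Qed.

(** Additivity iterated along [n] steps of length [u = t / n] gives linearity at the multiples of
    [u]; between them [B] is squeezed by monotonicity. *)
Lemma B_lin (e : R) : 0 < e -> exists2 t0, 0 < t0 < delta &
  forall s t : R, 0 < s -> s <= t -> t < t0 -> `|B s - s / t * B t| <= e * B t.
Proof.
move=> e0.
(* One grid step is worth [1/n < e/4] in units of [B t], and [n] additivity errors of size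
   [e' = e / (4n)] add up to [e/4]. *)
pose n := (Num.truncn (4 / e)).+1.
have n0 : 0 < n%:R :> R by rewrite ltr0n.
have nV : n%:R^-1 < e / 4.
  rewrite -[ltRHS]invrK ltf_pV2 ?posrE ?invr_gt0 ?divr_gt0// invf_div.
  exact: truncnS_gt.
have e'0 : 0 < e / 4 / n%:R by rewrite !divr_gt0.
set e' := e / 4 / n%:R in e'0.
have e'n : n%:R * e' = e / 4 by rewrite /e'; field; rewrite gt_eqF.
have [t0 /andP[t00 t0d] ht] := B_add e'0; exists t0; first by rewrite t00.
move=> s t s0 st tt0; have t_0 : 0 < t by lra.
have Bt0 : 0 < B t by apply: B_gt0; rewrite t_0; lra.
set u := t / n%:R.
have u0 : 0 < u by rewrite divr_gt0.
have un : n%:R * u = t by rewrite /u mulrC divfK// gt_eqF.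
have ku k : (k <= n)%N -> k%:R * u <= t.
  by move=> kn; rewrite -un ler_pM2r// ler_nat.
have step k : (k.+1 <= n)%N ->
    `|B (k.+1%:R * u) - k.+1%:R * B u| <= k%:R * (e' * B t).
  elim: k => [_|k IH kn]; first by rewrite !mul1r subrr normr0 mul0r.
  have := IH (ltnW kn); have := ht (k.+1%:R * u) u.
  have -> : k.+1%:R * u + u = k.+2%:R * u by rewrite -[in RHS]natr1; ring.
  have k0 : 0 < k.+1%:R * u by rewrite mulr_gt0.
  have kt := ku _ kn.
  move=> /(_ k0 u0 (le_lt_trans kt tt0)).
  have Bk : B (k.+2%:R * u) <= B t by apply: B_le => //; [rewrite mulr_gt0|lra].
  have : e' * B (k.+2%:R * u) <= e' * B t by rewrite ler_pM2l.
  rewrite -[k.+2%:R]natr1 -[X in _ -> _ -> _ -> _ <= X * _]natr1.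
  rewrite !ler_norml => h1 /andP[? ?] /andP[? ?].
  by apply/andP; split; lra.
(* The last instance of [step] compares [B t] with [n * B u]; it is divided by [n]. *)
have Bu : `|B u - n%:R^-1 * B t| <= e' * B t.
  have := step n.-1; rewrite prednK// un => /(_ (leqnn n)).
  have : n.-1%:R * (e' * B t) <= n%:R * (e' * B t).
    apply: ler_wpM2r; first exact: ltW (mulr_gt0 e'0 Bt0).
    by rewrite ler_nat leq_pred.
  move=> h1 h2; have {h1 h2} := le_trans h2 h1.
  have -> : B t - n%:R * B u = n%:R * (n%:R^-1 * B t - B u).
    by field; rewrite gt_eqF.
  by rewrite normrM gtr0_norm// ler_pM2l// distrC.
have grid k : (0 < k <= n)%N ->
    `|B (k%:R * u) - k%:R / n%:R * B t| <= e / 2 * B t.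
  case: k => // k /andP[_ kn]; have := step k kn.
  have : `|k.+1%:R * B u - k.+1%:R / n%:R * B t| <= k.+1%:R * (e' * B t).
    by rewrite -mulrA -mulrBr normrM gtr0_norm// ler_pM2l.
  have : k.+1%:R * (e' * B t) <= e / 4 * B t.
    by rewrite mulrA ler_pM2r// -e'n ler_pM2r// ler_nat.
  have : k%:R * (e' * B t) <= e / 4 * B t.
    by rewrite mulrA ler_pM2r// -e'n ler_pM2r// ler_nat ltnW.
  rewrite !ler_norml => ? ? /andP[? ?] /andP[? ?].
  by apply/andP; split; lra.
have [->|] := eqVneq s t.
  by rewrite divff ?gt_eqF// mul1r subrr normr0 mulr_ge0// ltW.
move=> sNt; have {sNt}st : s < t by rewrite lt_neqAle sNt.
pose k := Num.truncn (s / u).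
have su0 : 0 <= s / u by rewrite divr_ge0 ?ltW.
have k1 : k%:R * u <= s by rewrite -ler_pdivlMr// truncn_le.
have k2 : s < k.+1%:R * u by rewrite -ltr_pdivrMr// truncnS_gt.
have kn : (k < n)%N.
  by rewrite -(ltr_nat R) -(ltr_pM2r u0) un (le_lt_trans k1).
have stE : s / t = s / u * n%:R^-1 by rewrite /u; field; rewrite !gt_eqF.
have c1 : k%:R / n%:R <= s / t.
  by rewrite stE ler_pM2r ?invr_gt0// ler_pdivlMr.
have c2 : s / t <= k.+1%:R / n%:R.
  by rewrite stE ler_pM2r ?invr_gt0// ltW// ltr_pdivrMr.
have {}c1 : k%:R / n%:R * B t <= s / t * B t by rewrite ler_pM2r.
have {}c2 : s / t * B t <= k.+1%:R / n%:R * B t by rewrite ler_pM2r.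
have nB : n%:R^-1 * B t <= e / 4 * B t by rewrite ler_pM2r// ltW.
have kS : k.+1%:R / n%:R * B t = k%:R / n%:R * B t + n%:R^-1 * B t.
  by rewrite -natr1; ring.
have up : B s <= B (k.+1%:R * u).
  by apply: B_le => //; [lra|have := ku _ kn; lra].
have := grid k.+1 kn; rewrite ler_norml => /andP[g1 g2].
have Bs0 : 0 < B s by apply: B_gt0; rewrite s0; lra.
rewrite ler_norml; apply/andP; split; last by lra.
(* Below the first multiple of [u] no positive grid point lies to the left. There [s / t * B t] is
   at most [e / 4 * B t], and [B s > 0] is enough. *)
have [k_0|k_gt0] := posnP k.
  rewrite k_0 mulr0n !mul0r in kS; rewrite k_0 in c2.
  have : 0 < e * B t by exact: mulr_gt0.
  lra.
have lo : B (k%:R * u) <= B s.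
  by apply: B_le => //; [rewrite mulr_gt0 ?ltr0n|lra].
have := grid k; rewrite k_gt0 (ltnW kn) => /(_ isT).
by rewrite ler_norml => /andP[? ?]; lra.
Qed.

(** By stationarity the increment over [[s, tau]] is close to [B (tau - s)], which [B_lin] replaces
    by a linear term. This is the input of [maximal_ineq] with drift [B tau / tau]. *)
Lemma uniform_drift (e h : R) : 0 < e -> 0 < h -> exists2 t0, 0 < t0 < delta &
  forall tau : R, 0 < tau -> tau < t0 -> exists G,
    [/\ measurable G, pr P (~` G) <= h &
      forall w, G w -> good_path (Y ^~ w) /\ forall s, 0 <= s -> s <= tau ->
        `|Y s w - s / tau * B tau| <= e * B tau].
Proof.
move=> e0 h0; have e40 : 0 < e / 4 by lra.
(* The bound 1/2 is the hypothesis of [maximal_ineq]; [h / 2] absorbs its factor 2. *)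
have h'0 : 0 < Num.min (2^-1) (h / 2) by rewrite lt_min; apply/andP; split; lra.
have [t1 /andP[t10 t1d] ht1] := conv e40 h'0.
have [t2 /andP[t20 t2d] ht2] := B_lin e40.
exists (Num.min t1 t2); first by rewrite lt_min t10 t20 gt_min t1d.
move=> tau tau0; rewrite lt_min => /andP[tau1 tau2].
have Bt0 : 0 < B tau by apply: B_gt0; rewrite tau0; lra.
have dev s : 0 <= s -> s < tau -> pr P
    [set w | e / 2 * B tau < `|Y tau w - Y s w - B tau / tau * (tau - s)|] <=
    Num.min (2^-1) (h / 2).
  move=> s0 st; rewrite (pr_incr_dev LY _ _ s0 (ltW st)).
  have u0 : 0 < tau - s by lra.
  have ut : tau - s <= tau by lra.
  have u1 : 0 < tau - s < t1 by rewrite u0; lra.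
  apply: le_trans (ht1 _ u1); apply: le_pr; try exact: (measurable_dev0_gt LY).
  move=> w /=; set u := tau - s in u0 ut u1 *.
  have := ht2 u tau u0 ut tau2.
  have Bu : B u <= B tau by apply: B_le => //; lra.
  have : e / 4 * B u <= e / 4 * B tau by rewrite ler_pM2l.
  have -> : u / tau * B tau = B tau / tau * u by ring.
  rewrite !ltNge => h1 h2; apply: contra => h3.
  rewrite (_ : _ - _ = (Y u w - B u) + (B u - B tau / tau * u)); last by ring.
  by apply: (le_trans (ler_normD _ _)); lra.
have [|G [mG PG HG]] :=
    maximal_ineq (c := B tau / tau) (a := e / 2 * B tau) LY tau0.
  move=> s s0; rewrite le_eqVlt => /orP[/eqP ->|st]; last first.
    by apply: le_trans (dev s s0 st) _; rewrite ge_min lexx.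
  (* At [s = tau] the increment is identically zero, whereas [conv] covers positive lengths only. *)
  rewrite (_ : [set w | _] = set0) ?pr0 ?invr_ge0//.
  apply/seteqP; split => // w /=; rewrite !subrr mulr0 subr0 normr0.
  by rewrite ltNge mulr_ge0// ltW//; lra.
exists G; split => //.
  apply: (le_trans PG).
  have := dev 0 (lexx 0) tau0; rewrite le_min => /andP[_]; lra.
move=> w /HG[gw Hw]; split => // s s0 st; have := Hw s s0 st.
have -> : B tau / tau * s = s / tau * B tau by ring.
by move=> /le_trans; apply; lra.
Qed.

Lemma pr_increments_le (u x : R) K : 0 <= u ->
  pr P (\bigcap_(k in `I_K)
    [set w | `|Y (k.+1%:R * u) w - Y (k%:R * u) w| <= x])
  = (1 - pr P [set w | x < `|Y u w - 0|]) ^+ K.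
Proof.
move=> u0; case: (LY) => _ indY _ _.
have t0 : 0 <= 0%:R * u by rewrite mul0r.
have tnd i : i%:R * u <= i.+1%:R * u by rewrite ler_wpM2r// ler_nat.
pose V := [set y : R | `|y| <= x].
have mV : measurable V.
  rewrite (_ : V = `[- x, x]%classic)//.
  by rewrite /V; apply/seteqP; split => y /=; rewrite in_itv/= ler_norml.
have := indep_increments_nat indY t0 tnd K (fun=> mV).
rewrite /pr => ->; rewrite -/(pr P _).
have E k : [set w | `|Y (k.+1%:R * u) w - Y (k%:R * u) w| <= x] =
    ~` [set w | x < `|Y (k.+1%:R * u) w - Y (k%:R * u) w - 0|].
  apply/seteqP; split => w /=; first by rewrite subr0 leNgt => /negP.
  by move=> /negP; rewrite -leNgt subr0.
have Pk k : P [set w | `|Y (k.+1%:R * u) w - Y (k%:R * u) w| <= x] =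
    (1 - pr P [set w | x < `|Y u w - 0|])%:E.
  have mE : measurable [set w | x < `|Y (k.+1%:R * u) w - Y (k%:R * u) w - 0|].
    exact: measurable_dev_gt.
  rewrite E prE; last exact: measurableC.
  rewrite prC// (pr_incr_dev LY _ _ _ (tnd k)) ?mulr_ge0//.
  by have -> : k.+1%:R * u - k%:R * u = u by rewrite -natr1; ring.
rewrite (eq_bigr (fun=> (1 - pr P [set w | x < `|Y u w - 0|])%:E)); last first.
  by move=> k _; exact: Pk.
by rewrite prodEFin /= prodr_const card_ord.
Qed.

(** From [(1 + q)^K >= 1 + K q] and [(1 - q^2)^K <= 1] follows [(1 - h) (1 + K q) <= 1], and
    [h <= 1/2] bounds [h / (1 - h)] by [2 h]. *)
Lemma bernoulli_tail (q h : R) K : 0 <= q -> q <= 1 -> h <= 2^-1 ->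
  1 - h <= (1 - q) ^+ K -> K%:R * q <= 2 * h.
Proof.
move=> q0 q1 h1 hq.
have Kq0 : 0 <= K%:R * q by rewrite mulr_ge0.
have B1 : 1 + K%:R * q <= (1 + q) ^+ K.
  elim: K {hq} Kq0 => [|K IH] _; first by rewrite mul0r addr0.
  have Kq0 : 0 <= K%:R * q by rewrite mulr_ge0.
  rewrite exprS -natr1; have := IH Kq0; set p := (1 + q) ^+ K => hp.
  have : 0 <= K%:R * q * q by rewrite mulr_ge0.
  have : 0 <= q * (p - (1 + K%:R * q)) by rewrite mulr_ge0// subr_ge0.
  lra.
have B2 : (1 - q) ^+ K * (1 + q) ^+ K <= 1.
  rewrite -exprMn exprn_ile1//; nra.
have : (1 - h) * (1 + K%:R * q) <= 1.
  apply: le_trans B2; apply: ler_pM => //; lra.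
have : 0 <= (2^-1 - h) * (K%:R * q) by rewrite mulr_ge0// subr_ge0.
nra.
Qed.

(** The gain [2^-i] comes from [bernoulli_tail] applied to the [2^i] increments filling [[0, v]],
    [v = 2^i u]. Then [maximal_ineq] with zero drift makes the bound uniform on [[0, u]], doubling
    [3 B v] to [6 B v]. *)
Lemma scale_tail (h : R) : 0 < h -> exists2 t0, 0 < t0 < delta &
  forall i (u : R), 0 < u -> 2 ^+ i * u < t0 -> exists G,
    [/\ measurable G, pr P (~` G) <= h / 2 ^+ i &
      forall w, G w -> good_path (Y ^~ w) /\ forall s, 0 <= s -> s <= u ->
        `|Y s w| <= 6 * B (2 ^+ i * u)].
Proof.
(* The bound 1/2 serves both [bernoulli_tail] and [maximal_ineq]; [h / 4] is chosen because the
   final probability is at most [2 q <= 4 h' / 2^i]. *)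
move=> h0; pose h' := Num.min (2^-1) (h / 4).
have h'0 : 0 < h' by rewrite lt_min; apply/andP; split; lra.
have e0 : 0 < (2^-1 : R) by lra.
have [t0 t0d ht] := uniform_drift e0 h'0; exists t0 => //.
move=> i u u0 ut0; set v := 2 ^+ i * u in ut0 *.
have p0 : 0 < (2 : R) ^+ i by rewrite exprn_gt0.
have v0 : 0 < v by rewrite mulr_gt0.
have Bv0 : 0 < B v.
  by apply: B_gt0; rewrite v0; case/andP: t0d => _; exact: lt_trans.
have uv : u <= v by rewrite /v -[leLHS]mul1r ler_pM2r// exprn_ege1// ler1n.
have [G [mG PG HG]] := ht v v0 ut0.
(* The drift contributes at most [B v] and the error at most [B v / 2]. *)
have small w s : G w -> 0 <= s -> s <= v -> `|Y s w| <= 3 / 2 * B v.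
  move=> /HG[_ Hw] s0 sv; have := Hw s s0 sv.
  have sv1 : s / v * B v <= B v.
    by apply: ler_piMl; [exact: ltW|rewrite ler_pdivrMr// mul1r].
  have : 0 <= s / v * B v.
    by apply: mulr_ge0; [apply: divr_ge0 => //|]; exact: ltW.
  rewrite !ler_norml => ? /andP[? ?]; apply/andP; split; lra.
have tail s : 0 <= s -> s <= v -> pr P [set w | 3 * B v < `|Y s w - 0|] <= h'.
  move=> s0 sv; apply: le_trans PG; apply: le_pr.
  - exact: (measurable_dev0_gt LY).
  - exact: measurableC.
  - move=> w /= h3 Gw; have := small w s Gw s0 sv; rewrite subr0 in h3; lra.
set q := pr P [set w | 3 * B v < `|Y u w - 0|].
have q0 : 0 <= q by exact: pr_ge0.
have q1 : q <= 1 by apply: pr_le1; exact: (measurable_dev0_gt LY).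
have hq : (2 ^ i)%:R * q <= 2 * h'.
  apply: bernoulli_tail => //; first by rewrite ge_min lexx.
  rewrite -(pr_increments_le _ _ (ltW u0)).
  have : 1 - h' <= pr P G by have := PG; rewrite prC//; lra.
  move=> /le_trans; apply; apply: le_pr => //.
    apply: fin_bigcap_measurable; first exact: finite_II.
    move=> k _; rewrite -[X in measurable X]setCK; apply: measurableC.
    have := measurable_dev_gt mY (k%:R * u) (k.+1%:R * u) (3 * B v) 0.
    congr (measurable _); apply/seteqP; split => w /=.
      by rewrite subr0 ltNge => /negP.
    by move=> /negP; rewrite -ltNge subr0.
  move=> w Gw k /= ki.
  have kv j : (j <= 2 ^ i)%N -> `|Y (j%:R * u) w| <= 3 / 2 * B v.
    move=> ji; apply: small => //; first by rewrite mulr_ge0 // ltW.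
    by rewrite /v ler_pM2r// -natrX ler_nat.
  apply: (le_trans (ler_normB _ _)).
  by have := kv _ ki; have := kv _ (ltnW ki); lra.
have h'2 : h' <= 2^-1 by rewrite ge_min lexx.
have h'4 : h' <= h / 4 by rewrite ge_min lexx orbT.
have [|G' [mG' PG' HG']] := maximal_ineq (c := 0) (a := 3 * B v) LY u0.
  move=> s s0 su; rewrite (pr_incr_dev LY _ _ s0 su) mul0r.
  apply: le_trans (tail _ _ _) h'2; first by rewrite subr_ge0.
  by lra.
exists G'; split => //.
  apply: (le_trans PG').
  rewrite (pr_incr_dev LY _ _ (lexx 0) (ltW u0)) mul0r subr0 -/q.
  rewrite ler_pdivlMr// -natrX; lra.
move=> w /HG'[gw Hw]; split => // s s0 su; have := Hw s s0 su.
rewrite mul0r subr0; lra.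
Qed.

Lemma pow2b : 1 <= (2 : R) `^ b < 2.
Proof.
have l : 1 <= (2 : R) `^ b.
  by rewrite -[leLHS](powRr0 2); apply: ler_powR; rewrite ?ler1n.
rewrite l /= -[ltRHS]powRr1//.
rewrite lt_neqAle; apply/andP; split; last first.
  by apply: ler_powR; rewrite ?ler1n ?ltW.
have n0 : ln 2 != 0 :> R by rewrite gt_eqF// ln_gt0// ltr1n.
apply/eqP => /(congr1 (@ln R)); rewrite !ln_powR => /(mulIf n0) b1.
by move: b_lt1; rewrite b1 ltxx.
Qed.

(** [B_lin] at [s = t / 2] gives [B (t / 2) <= (1/2 + e) B t] for any [e > 0], and [b < 1] leaves
    room for [rho] strictly between 1/2 and [2^-b]. The bound is then iterated. *)
Lemma B_half : exists rho, [/\ 2^-1 < rho, rho * 2 `^ b < 1 &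
  exists2 t0, 0 < t0 < delta & forall t n, 0 < t < t0 ->
    B (t / 2 ^+ n) <= rho ^+ n * B t].
Proof.
have /andP[b1 b2] := pow2b; set beta := (2 : R) `^ b in b1 b2 *.
have beta0 : 0 < beta by lra.
have Vb : 2^-1 < beta^-1 by rewrite ltf_pV2 ?posrE.
have bV : beta^-1 * beta = 1 by rewrite mulVf// gt_eqF.
pose rho := (2^-1 + beta^-1) / 2; exists rho.
have r1 : 2^-1 < rho by rewrite /rho; lra.
split => //.
  rewrite -bV ltr_pM2r// /rho; lra.
have e0 : 0 < rho - 2^-1 by lra.
have [t0 t0d ht] := B_lin e0.
exists t0 => // t n /andP[t_0 tt0]; elim: n => [|n IH].
  by rewrite expr0 divr1 mul1r.
pose u := t / 2 ^+ n.
have p0 : 0 < (2 : R) ^+ n by rewrite exprn_gt0.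
have u0 : 0 < u by rewrite divr_gt0.
have ut : u <= t.
  by rewrite ler_pdivrMr// -[leLHS]mulr1 ler_pM2l// exprn_ege1// ler1n.
have -> : t / 2 ^+ n.+1 = u / 2 by rewrite /u exprS invfM mulrA mulrAC.
have u20 : 0 < u / 2 by lra.
have u2u : u / 2 <= u by lra.
have := ht (u / 2) u u20 u2u (le_lt_trans ut tt0).
have -> : u / 2 / u = 2^-1 by field; rewrite gt_eqF.
rewrite ler_norml => /andP[_ h].
have : B (u / 2) <= rho * B u by lra.
move=> /le_trans; apply; rewrite exprS -mulrA ler_pM2l//; lra.
Qed.

(** Close to time 0 the error of [uniform_drift] may exceed the boundary, so time is cut into blocks
    with right ends [u i = t / 2^((m+1) i)]. On block [i], [scale_tail] and [B_half] bound the path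
    by [6 rho^(m i) B t], while the boundary is at least [2^(-b (m+1) (i+1)) B t]. *)
Lemma small_times (h : R) : 0 < h ->
  exists a0 t0, [/\ 0 < a0 < 1, 0 < t0 < delta &
  forall t, 0 < t -> t < t0 -> exists G,
    [/\ measurable G, pr P (~` G) <= h &
      forall w, G w -> forall s, 0 < s -> s <= a0 * t ->
        `|Y s w| <= B t * (s / t) `^ b]].
Proof.
move=> h0; have [rho [r1 r2 [t1 /andP[t10 t1d] ht1]]] := B_half.
have /andP[b1 b2] := pow2b; set beta := (2 : R) `^ b in b1 b2 r2 *.
have h20 : 0 < h / 2 by lra.
have [t2 /andP[t20 t2d] ht2] := scale_tail h20.
have beta0 : 0 < beta by lra.
have rb0 : 0 <= rho * beta by rewrite mulr_ge0//; lra.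
have bV0 : 0 < 2^-1 / beta by rewrite divr_gt0.
(* This [m] gives [rho^m * beta^(m+1) <= 1/2]: each further block at least halves the ratio of the
   path bound to the boundary. *)
have [m hm] := exp_lt_ex rb0 r2 bV0.
have hm2 : rho ^+ m * beta ^+ m.+1 <= 2^-1.
  rewrite exprSr mulrA -exprMn.
  by have := ltW hm; rewrite ler_pdivlMr.
have c0 : 0 < (6 * beta ^+ m.+1)^-1 by rewrite invr_gt0 mulr_gt0// exprn_gt0.
have half1 : (2^-1 : R) < 1 by lra.
have half0 : 0 <= (2^-1 : R) by lra.
(* [2^-i1] absorbs the remaining constant [6 beta^(m+1)]; passing to the successor keeps [i0]
   positive, whence [a0 < 1]. *)
have [i1 hi1] := exp_lt_ex half0 half1 c0.
pose i0 := i1.+1.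
have hi0 i : (i0 <= i)%N -> 6 * beta ^+ m.+1 * 2^-1 ^+ i <= 1.
  move=> ii; have : 2^-1 ^+ i <= (2^-1 : R) ^+ i1.
    by apply: ler_wiXn2l => //; [exact: ltW|exact: ltnW].
  move=> /le_trans /(_ (ltW hi1)); rewrite -(ler_pM2l (x := 6 * beta ^+ m.+1)).
    by rewrite divff// gt_eqF// mulr_gt0// exprn_gt0.
  by rewrite mulr_gt0// exprn_gt0.
(* The right side is the boundary, in units of [B t], at the left end of block [i]. *)
have key i : (i0 <= i)%N -> 6 * rho ^+ (m * i) <= (beta ^+ (m.+1 * i.+1))^-1.
  move=> ii; rewrite -[leRHS]mul1r ler_pdivlMr ?exprn_gt0//.
  rewrite mulnS exprD -mulrA [X in _ * X]mulrCA -[rho ^+ _ * _]mulrC.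
  have -> : 6 * (beta ^+ m.+1 * (beta ^+ (m.+1 * i) * rho ^+ (m * i))) =
    6 * beta ^+ m.+1 * (rho ^+ m * beta ^+ m.+1) ^+ i.
    by rewrite exprMn -!exprM; ring.
  apply: le_trans (hi0 i ii); rewrite ler_pM2l ?mulr_gt0 ?exprn_gt0//.
  by apply: lerXn2r; rewrite ?nnegrE// mulr_ge0 ?exprn_ge0//; lra.
exists ((2 ^+ (m.+1 * i0))^-1), (Num.min t1 t2); split.
- rewrite invr_gt0 exprn_gt0//= invf_lt1 ?exprn_gt0// exprn_egt1 ?ltr1n//.
- by rewrite lt_min t10 t20 gt_min t1d.
move=> t t_0; rewrite lt_min => /andP[tt1 tt2].
have Bt0 : 0 < B t by apply: B_gt0; rewrite t_0; lra.
pose u i := t / 2 ^+ (m.+1 * i).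
have u0 i : 0 < u i by rewrite divr_gt0// exprn_gt0.
have uv i : 2 ^+ i * u i = t / 2 ^+ (m * i).
  rewrite /u mulSn exprD invfM mulrCA mulVKf//.
have vt i : 2 ^+ i * u i < t2.
  rewrite uv; apply: le_lt_trans tt2; rewrite ler_pdivrMr ?exprn_gt0//.
  by rewrite -[leLHS]mulr1 ler_pM2l// exprn_ege1// ler1n.
have /choice[G HG] := fun i => ht2 i (u i) (u0 i) (vt i).
have mG i : measurable (G i) by case: (HG i).
have mGC i : measurable (~` G i) by exact: measurableC.
(* Failures on the first [n] blocks from [i0] on; their probabilities sum geometrically to at most
   [h (1 - 2^-n)]. *)
pose F n := \big[setU/set0]_(j < n) ~` G (i0 + j)%N.
have mF n : measurable (F n) by apply: bigsetU_measurable.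
have PF n : pr P (F n) <= h * (1 - 2^-1 ^+ n).
  elim: n => [|n IH]; first by rewrite /F big_ord0 pr0 expr0 subrr mulr0.
  have -> : F n.+1 = F n `|` ~` G (i0 + n)%N by rewrite /F big_ord_recr.
  apply: (le_trans (prU _ (mF n) (mGC _))).
  have [_ PG _] := HG (i0 + n)%N.
  have : h / 2 / 2 ^+ (i0 + n) <= h / 2 * 2^-1 ^+ n.
    rewrite ler_pM2l// exprVn lef_pV2 ?posrE ?exprn_gt0//.
    by rewrite ler_eXn2l ?ltr1n// leq_addl.
  by rewrite exprS; lra.
have ndF : nondecreasing_seq F.
  apply/nondecreasing_seqP => n; apply/subsetPset.
  have -> : F n.+1 = F n `|` ~` G (i0 + n)%N by rewrite /F big_ord_recr.
  exact: subsetUl.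
have mU : measurable (\bigcup_n F n) by exact: bigcup_measurable.
exists (~` \bigcup_n F n); split; first exact: measurableC.
  rewrite setCK; apply: (le_pr_bigcup mF ndF) => n.
  apply: (le_trans (PF n)).
  by rewrite -[leRHS]mulr1 ler_pM2l// gerBl exprn_ge0.
move=> w nF s s0; rewrite mulrC => sa.
have [i [ii si1 si2]] := halving_bracket s0 t_0 sa.
have Gi : G i w.
  apply: contrapT => nG; apply: nF; exists (i - i0).+1 => //.
  by rewrite /F big_ord_recr/=; right; rewrite subnKC.
have [_ _ /(_ w Gi)[_ /(_ s (ltW s0) si2)]] := HG i.
move=> /le_trans; apply; rewrite uv.
apply: (@le_trans _ _ (6 * (rho ^+ (m * i) * B t))).
  by rewrite ler_pM2l// ht1// t_0.
rewrite mulrA mulrC ler_pM2l//; apply: (le_trans (key i ii)).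
rewrite -powR_expV; apply: ge0_ler_powR => //.
- by rewrite nnegrE invr_ge0 exprn_ge0.
- by rewrite nnegrE divr_ge0// ltW.
- by rewrite ler_pdivlMr// mulrC ltW.
Qed.

End Scales.

(** * Pathwise comparison of a line with a power boundary *)

Section Deterministic.
Context {R : realType}.

(** For [0 <= b < 1] the power [x^b] lies between 1 and [x]. *)
Lemma powR_between (b e x : R) : 0 <= b -> b < 1 -> 0 < e -> e < 1 ->
  1 - e <= x -> x <= 1 + e -> `|x `^ b - 1| <= e.
Proof.
move=> b0 b1 e0 e1 x1 x2; have [x_1|x_1] := leP x 1.
  have h : 0 < x <= 1 by apply/andP; split => //; lra.
  have l : x <= x `^ b by apply: ger1_powR => //; exact: ltW.
  have u : x `^ b <= 1 by rewrite -[leRHS](powRr0 x); apply: ger_powR.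
  by rewrite ler_norml; apply/andP; split; lra.
have u : x `^ b <= x by apply: ler1_powR; exact: ltW.
have l : 1 <= x `^ b.
  by rewrite -[leLHS](powRr0 x); apply: ler_powR => //; exact: ltW.
by rewrite ler_norml; apply/andP; split; lra.
Qed.

(* The line x and the boundary x^b are apart away from x = 0 and x = 1. *)
Lemma powR_gap (b e a0 : R) : b < 1 -> 0 < e -> e < 1 -> 0 < a0 -> exists2 k,
  0 < k & (forall x, a0 <= x -> x <= 1 - e -> x + k <= x `^ b) /\
          (1 + e) `^ b + k < 1 + e.
Proof.
move=> b1 e0 e1 a00.
pose g := (1 - e) `^ (1 - b).
have c0 : 0 < 1 - b by lra.
have g1 : g < 1.
  have p1 : 1 `^ (1 - b) = 1 :> R by rewrite powR1.
  rewrite /g -[ltRHS]p1; apply: gt0_ltr_powR; rewrite ?nnegrE; lra.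
have h1 : (1 + e) `^ b < 1 + e.
  rewrite -[ltRHS]powRr1; last by lra.
  rewrite lt_neqAle; apply/andP; split; last by apply: ler_powR; lra.
  have n0 : ln (1 + e) != 0 :> R by rewrite gt_eqF// ln_gt0//; lra.
  apply/eqP => /(congr1 (@ln R)); rewrite !ln_powR => /(mulIf n0) bb.
  by move: b1; rewrite bb ltxx.
(* On [[a0, 1 - e]], [x = x^b * x^(1-b) <= x^b * g], so the gap is at least
   [x^b (1 - g) >= a0 (1 - g)]. Halving the gap at [1 + e] keeps the second inequality strict. *)
exists (Num.min (a0 * (1 - g)) ((1 + e - (1 + e) `^ b) / 2)).
  by rewrite lt_min; apply/andP; split; [apply: mulr_gt0 => //|]; lra.
split; last first.
  have : Num.min (a0 * (1 - g)) ((1 + e - (1 + e) `^ b) / 2) <=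
    (1 + e - (1 + e) `^ b) / 2 by rewrite ge_min lexx orbT.
  lra.
move=> x ax xe; have x0 : 0 < x by lra.
have : Num.min (a0 * (1 - g)) ((1 + e - (1 + e) `^ b) / 2) <= a0 * (1 - g).
  by rewrite ge_min lexx.
have xb0 : 0 < x `^ b by exact: powR_gt0.
have xE : x = x `^ b * x `^ (1 - b).
  rewrite -powRD; last by rewrite (lt0r_neq0 x0) implybT.
  by rewrite addrC subrK powRr1// ltW.
have xg : x `^ (1 - b) <= g.
  by apply: ge0_ler_powR => //; rewrite ?nnegrE; lra.
have xb : x <= x `^ b by apply: ger1_powR; [apply/andP; split|]; lra.
have : a0 * (1 - g) <= x `^ b * (1 - g).
  by apply: ler_wpM2r; lra.
have : x `^ b * x `^ (1 - b) <= x `^ b * g by rewrite ler_pM2l.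
rewrite -xE; lra.
Qed.

(** The bound [e < 1/8] keeps [q >= 3/4 M], so [|p - q| <= 4 e M <= 6 e q]. *)
Lemma ratio_near1 (p q M e : R) : 0 < M -> 0 < e -> e < 8^-1 ->
  `|p - M| <= 2 * e * M -> `|q - M| <= 2 * e * M -> `|p / q - 1| <= 6 * e.
Proof.
move=> M0 e0 e1 hp hq.
have q0 : 3 / 4 * M <= q.
  have : e * M <= 8^-1 * M by rewrite ler_pM2r// ltW.
  by move: hq; rewrite ler_norml => /andP[? ?]; lra.
have q1 : 0 < q by apply: lt_le_trans q0; rewrite mulr_gt0.
have -> : p / q - 1 = (p - q) / q by field; rewrite gt_eqF.
rewrite normrM normfV (gtr0_norm q1) ler_pdivrMr//.
have h : `|p - q| <= 4 * e * M.
  have -> : p - q = (p - M) - (q - M) by ring.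
  by apply: (le_trans (ler_normB _ _)); lra.
apply: (le_trans h); have : e * (3 / 4 * M) <= e * q by rewrite ler_pM2l.
have : 0 < e * M by exact: mulr_gt0.
lra.
Qed.

(** [Tbar] and [Tstar] are the cases [z = X] and [z = |X|], up to conversion. *)
Definition passage (z : R -> R) (b r : R) : \bar R :=
  ereal_inf [set t%:E | t in [set t : R | 0 <= t /\ r * t `^ b < z t]].

(** Abstracts the identity and the absolute value, so that both parts of the theorem share one
    argument: the lower bound transfers crossings, the upper bound transfers staying below, and the
    last clause transfers closeness to a nonnegative value. *)
Definition size_like (phi : R -> R) :=
  [/\ phi 0 = 0, forall x, x <= phi x, forall x, phi x <= `|x| &
      forall x z, 0 <= z -> `|phi x - z| <= `|x - z|].

Lemma size_like_id : size_like id.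
Proof. by split => // x; exact: ler_norm. Qed.

Lemma size_like_norm : size_like (fun x => `|x|).
Proof.
split => // [|x|x z z0]; first exact: normr0.
  exact: ler_norm.
by rewrite -[X in `| _ - X|](ger0_norm z0); exact: ler_dist_dist.
Qed.

(** At level [M / t^b] the boundary at time [s] is [M (s / t)^b]. The path is below it before
    [(1 - e) t] and above it at [(1 + e) t], which traps the infimum. The value at [T] is read off
    the uniform estimate, not off the crossing. *)
Lemma passage_bounds phi (y : R -> R) (b t M e k : R) :
  size_like phi -> 0 <= b -> 0 < t -> 0 < M -> 0 < e -> e < 1 ->
  y 0 = 0 ->
  (forall s, 0 < s -> s < (1 - e) * t -> `|y s| <= M * (s / t) `^ b) ->
  M * (1 + e) `^ b < y ((1 + e) * t) ->
  (forall s, 0 <= s -> s <= 2 * t -> `|y s - s / t * M| <= k * M) ->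
  exists T, [/\ passage (phi \o y) b (M / t `^ b) = T%:E, (1 - e) * t <= T,
    T <= (1 + e) * t & `|phi (y T) - T / t * M| <= k * M].
Proof.
move=> [phi0 phi1 phi2 phi3] b0 t0 M0 e0 e1 y0 small big unif.
have rE s : 0 <= s -> M / t `^ b * s `^ b = M * (s / t) `^ b.
  have tV : t^-1 `^ b = (t `^ b)^-1.
    by rewrite -(powR_inv1 (ltW t0)) -powRrM mulN1r powRN.
  have tV0 : 0 <= t^-1 by rewrite invr_ge0 ltW.
  by move=> s0; rewrite powRM// tV; ring.
have up : (passage (phi \o y) b (M / t `^ b) <= ((1 + e) * t)%:E)%E.
  apply: ereal_inf_lbound; exists ((1 + e) * t) => //; split.
    by rewrite mulr_ge0 ?ltW//; lra.
  rewrite rE ?mulfK ?gt_eqF//; last by rewrite mulr_ge0 ?ltW//; lra.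
  exact: lt_le_trans (phi1 _).
have lo : (((1 - e) * t)%:E <= passage (phi \o y) b (M / t `^ b))%E.
  apply: le_ereal_inf_tmp => _ [s [s0 hs] <-]; rewrite lee_fin leNgt.
  apply/negP => st; move: hs; apply/negP; rewrite -leNgt rE//.
  (* At time 0 the path vanishes and the boundary is nonnegative; for [b = 0] it equals [M]
     there. *)
  move: s0; rewrite le_eqVlt => /orP[/eqP <-|s0].
    by rewrite /= y0 phi0 mul0r mulr_ge0 ?powR_ge0// ltW.
  exact: le_trans (phi2 _) (small _ s0 st).
move: up lo; case: (passage (phi \o y) b (M / t `^ b)) => [T| |]//.
rewrite !lee_fin => T2 T1; exists T; split => //.
have T0 : 0 <= T by apply: le_trans T1; rewrite mulr_ge0 ?ltW//; lra.
apply: (le_trans (phi3 _ _ _)).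
  by rewrite mulr_ge0 ?divr_ge0 ?(ltW t0) ?(ltW M0).
by apply: unif => //; apply: (le_trans T2); rewrite ler_pM2r//; lra.
Qed.

End Deterministic.

(** * First passage over a small level *)

Section Passage.
Context {d : measure_display} {Omega : measurableType d} {R : realType}.
Variable P : probability Omega R.
Variable Y : R -> Omega -> R.
Variables (B C : R -> R) (b delta : R).
Hypothesis LY : levy_from0 P Y.
Hypothesis b_ge0 : 0 <= b.
Hypothesis b_lt1 : b < 1.
Hypothesis B_gt0 : forall t : R, 0 < t < delta -> 0 < B t.
Hypothesis B_cont : forall t : R, 0 < t < delta ->
     {for t, continuous (fun s => B s / s `^ b)}.
Hypothesis B_incr : forall s t : R, 0 < s -> s < t -> t < delta ->
     B s / s `^ b < B t / t `^ b.
Hypothesis C_inv : forall t : R, 0 < t < delta -> C (B t / t `^ b) = t.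
Hypothesis conv : forall e h : R, 0 < e -> 0 < h -> exists2 t0,
  0 < t0 < delta & forall t : R, 0 < t < t0 ->
    pr P [set w | e * B t < `|Y t w - B t|] <= h.

Ltac clear_locals := clear - P Y B C b delta LY b_ge0 b_lt1 B_gt0 B_cont
  B_incr C_inv conv.

(** Each halving of [t] multiplies the bound on [B t / t^b] by [rho * 2^b < 1], so values below [r]
    occur; the intermediate value theorem does the rest. *)
Lemma level_reached (t1 : R) : 0 < t1 -> exists2 r1, 0 < r1 &
  forall r, 0 < r -> r < r1 -> exists t, [/\ 0 < t, t < t1, t < delta &
    B t / t `^ b = r].
Proof.
move=> t10; have [rho [rho1 rho2 [t0 /andP[t00 t0d] ht]]] :=
  B_half LY b_ge0 b_lt1 B_gt0 B_incr conv.
pose m := Num.min t0 t1; pose tt := m / 2.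
have m0 : 0 < m by rewrite lt_min t00.
have mt0 : m <= t0 by rewrite ge_min lexx.
have mt1 : m <= t1 by rewrite ge_min lexx orbT.
have tt0 : 0 < tt < t0 by rewrite /tt; apply/andP; split; lra.
have tt_0 : 0 < tt by case/andP: tt0.
have Btt : 0 < B tt by apply: B_gt0; rewrite tt_0 /tt; lra.
have beta0 : 0 < (2 : R) `^ b by exact: powR_gt0.
pose f (t : R) := B t / t `^ b.
have ftt : 0 < f tt by rewrite /f divr_gt0// powR_gt0.
exists (f tt) => // r r0 rf.
have rb0 : 0 <= rho * 2 `^ b by rewrite mulr_ge0 ?ltW//; lra.
have rff : 0 < r / f tt by exact: divr_gt0.
have [n hn] := exp_lt_ex rb0 rho2 rff.
have p0 : 0 < (2 : R) ^+ n by exact: exprn_gt0.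
have fn : f (tt / 2 ^+ n) < r.
  move: hn; rewrite ltr_pdivlMr//; apply: le_lt_trans.
  have E1 : (tt / 2 ^+ n) `^ b = tt `^ b / (2 `^ b) ^+ n.
    by rewrite powRM ?powR_expV ?(ltW tt_0)// invr_ge0 ltW.
  have -> : f (tt / 2 ^+ n) = B (tt / 2 ^+ n) * ((2 `^ b) ^+ n / tt `^ b).
    by rewrite /f E1 invfM invrK [X in _ * X]mulrC.
  have -> : (rho * 2 `^ b) ^+ n * f tt =
      rho ^+ n * B tt * ((2 `^ b) ^+ n / tt `^ b).
    by rewrite exprMn /f; ring.
  by rewrite ler_pM2r ?ht// divr_gt0 ?exprn_gt0 ?powR_gt0.
have ab : tt / 2 ^+ n <= tt.
  by rewrite ler_pdivrMr// -[leLHS]mulr1 ler_pM2l// exprn_ege1// ler1n.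
have cf : {within `[tt / 2 ^+ n, tt], continuous f}.
  apply: continuous_in_subspaceT => x; rewrite inE/= in_itv/= => /andP[x1 x2].
  apply: B_cont; apply/andP; split; last by lra.
  by apply: lt_le_trans x1; exact: divr_gt0.
have [|c] := @IVT R f _ _ r ab cf.
  by rewrite ge_min le_max (ltW fn) (ltW rf) orbT.
rewrite in_itv/= => /andP[c1 c2] fc; exists c; split => //.
- by apply: lt_le_trans c1; exact: divr_gt0.
- by apply: (le_lt_trans c2); rewrite /tt; lra.
- by apply: (le_lt_trans c2); rewrite /tt; lra.
Qed.

(** [small_times] covers [s <= a0 t]. From there to [(1 - e) t], and again at [(1 + e) t], the gap
    between line and boundary dominates the error of the uniform drift estimate. *)
Lemma good_scale (e h : R) : 0 < e -> e < 1 -> 0 < h ->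
  exists2 t0, 0 < t0 < delta &
  forall t, 0 < t -> t < t0 ->
    (forall s, 0 < s -> s <= 2 * t -> `|B s - s / t * B t| <= e * B t) /\
    exists G, [/\ measurable G, pr P (~` G) <= h & forall w, G w ->
      [/\ Y 0 w = 0,
        forall s, 0 < s -> s < (1 - e) * t -> `|Y s w| <= B t * (s / t) `^ b,
        B t * (1 + e) `^ b < Y ((1 + e) * t) w &
        forall s, 0 <= s -> s <= 2 * t -> `|Y s w - s / t * B t| <= e * B t]].
Proof.
move=> e0 e1 h0; have h20 : 0 < h / 2 by lra.
have [a0 [t1 [/andP[a00 a01] /andP[t10 t1d] ht1]]] :=
  small_times LY b_ge0 b_lt1 B_gt0 B_incr conv h20.
have [k' k'0 [gap1 gap2]] := powR_gap b_lt1 e0 e1 a00.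
pose k := Num.min k' e.
have k0 : 0 < k by rewrite lt_min k'0.
have kk' : k <= k' by rewrite ge_min lexx.
have ke : k <= e by rewrite ge_min lexx orbT.
(* The drift estimate is used on [[0, 2t]] in units of [B (2t) <= 4 B t]: its error [k/12] costs
   [k/3], and replacing [B (2t)] by [2 B t] costs [2k/3]. *)
have k120 : 0 < k / 12 by lra.
have [t2 /andP[t20 t2d] ht2] :=
  uniform_drift LY b_ge0 B_gt0 B_incr conv k120 h20.
have [t3 /andP[t30 t3d] ht3] := B_lin LY b_ge0 B_gt0 B_incr conv k120.
pose t0 := Num.min t1 (Num.min (t2 / 2) (t3 / 2)); exists t0.
  rewrite /t0 !lt_min t10 !divr_gt0//=.
  by apply: le_lt_trans t1d; rewrite ge_min lexx.
move=> t t_0; rewrite /t0 !lt_min => /and3P[tt1 tt2 tt3].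
have t20' : 0 < 2 * t by move: t_0; clear_locals; lra.
have t2t3 : 2 * t < t3 by move: tt3; clear_locals; lra.
have t2t2 : 2 * t < t2 by move: tt2; clear_locals; lra.
have Bt0 : 0 < B t.
  by apply: B_gt0; rewrite t_0/=; move: tt1 t1d; clear_locals; lra.
have B20 : 0 < B (2 * t).
  by apply: B_gt0; rewrite t20'/=; move: t2t3 t3d; clear_locals; lra.
have tle : t <= 2 * t by move: t_0; clear_locals; lra.
have := ht3 t (2 * t) t_0 tle t2t3.
have -> : t / (2 * t) = 2^-1 by field; rewrite gt_eqF.
rewrite ler_norml => /andP[B1 B2].
have kB1 : k / 12 * B (2 * t) <= 12^-1 * B (2 * t).
  by rewrite ler_pM2r//; move: ke e1; clear_locals; lra.
have B4 : B (2 * t) <= 4 * B t by move: B1 B2 kB1; clear_locals; lra.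
have kB4 : k / 12 * B (2 * t) <= k / 12 * (4 * B t) by rewrite ler_pM2l.
have Bd : `|B (2 * t) - 2 * B t| <= 2 / 3 * k * B t.
  move: B1 B2 kB4; clear_locals; move=> ? ? ?.
  by rewrite ler_norml; apply/andP; split; lra.
have shift s : 0 <= s -> s <= 2 * t ->
    `|s / (2 * t) * B (2 * t) - s / t * B t| <= 2 / 3 * k * B t.
  move=> s0 st.
  have -> : s / (2 * t) * B (2 * t) - s / t * B t =
    s / (2 * t) * (B (2 * t) - 2 * B t) by field; rewrite gt_eqF.
  have q0 : 0 <= s / (2 * t) by rewrite divr_ge0 ?(ltW t20').
  rewrite normrM ger0_norm//; apply: le_trans Bd.
  by rewrite ler_piMl// ler_pdivrMr// mul1r.
have keB : k * B t <= e * B t by rewrite ler_pM2r.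
split.
  move=> s s0 st; have := ht3 s (2 * t) s0 st t2t3; have := shift s (ltW s0) st.
  move: keB kB4; clear_locals; rewrite !ler_norml => ? ? /andP[? ?] /andP[? ?].
  by apply/andP; split; lra.
have [G1 [mG1 PG1 HG1]] := ht1 t t_0 tt1.
have [G2 [mG2 PG2 HG2]] := ht2 (2 * t) t20' t2t2.
exists (G1 `&` G2); split; first exact: measurableI.
  rewrite setCI; apply: (le_trans (prU _ _ _));
    [exact: measurableC|exact: measurableC|].
  by move: PG1 PG2; clear_locals; lra.
move=> w [G1w G2w]; have [[Y0 _] uni] := HG2 w G2w.
have unif s : 0 <= s -> s <= 2 * t -> `|Y s w - s / t * B t| <= k * B t.
  move=> s0 st; have := uni s s0 st; have := shift s s0 st.
  move: kB4; clear_locals; rewrite !ler_norml => ? /andP[? ?] /andP[? ?].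
  by apply/andP; split; lra.
split => //.
- move=> s s0 st; have [sa|sa] := leP s (a0 * t); first exact: HG1.
  have s2t : s <= 2 * t.
    by apply: (le_trans (ltW st)); rewrite ler_pM2r//;
      move: e0; clear_locals; lra.
  have := unif s (ltW s0) s2t.
  have x1 : a0 <= s / t by rewrite ler_pdivlMr// ltW.
  have x2 : s / t <= 1 - e by rewrite ler_pdivrMr// ltW.
  have := gap1 _ x1 x2.
  have x0 : 0 <= s / t * B t.
    by rewrite mulr_ge0 ?divr_ge0 ?(ltW Bt0) ?(ltW s0) ?(ltW t_0).
  rewrite -(ler_pM2l Bt0) !ler_norml => g /andP[a1 a2].
  have kk'B : k * B t <= k' * B t by rewrite ler_pM2r.
  move: g a1 a2 kk'B x0; clear_locals; move=> ? ? ? ? ?.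
  by apply/andP; split; lra.
- have s0 : 0 <= (1 + e) * t.
    by rewrite mulr_ge0 ?(ltW t_0)//; move: e0; clear_locals; lra.
  have st : (1 + e) * t <= 2 * t.
    by rewrite ler_pM2r//; move: e1; clear_locals; lra.
  have := unif _ s0 st; rewrite mulfK ?gt_eqF// ler_norml => /andP[a1 _].
  have a2 : B t * ((1 + e) `^ b + k') < B t * (1 + e) by rewrite ltr_pM2l.
  have kk'B : k * B t <= k' * B t by rewrite ler_pM2r.
  by move: a1 a2 kk'B; clear_locals; lra.
- by move=> s s0 st; apply: le_trans keB; exact: unif.
Qed.

(** A small [r] is [B t / t^b] with [t = C r]. At that scale the value at passage and all four
    denominators are within [2 e B t] of [B t]. *)
Lemma passage_ratios phi (eps h : R) : size_like phi -> 0 < eps -> 0 < h ->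
  exists2 r1, 0 < r1 & forall r, 0 < r -> r < r1 -> exists G,
    [/\ measurable G, pr P (~` G) <= h & forall w, G w ->
      let T := passage (phi \o Y ^~ w) b r in
      let t := fine T in let x := phi (Y t w) in
      (T < +oo)%E /\
      [/\ `|x / (r * t `^ b) - 1| <= eps, `|x / B t - 1| <= eps,
          `|x / B (C r) - 1| <= eps & `|x / (r * C r `^ b) - 1| <= eps]].
Proof.
(* [1/16] meets the requirement [e < 1/8] of [ratio_near1], and [eps / 6] brings its conclusion
   [6 e] below [eps]. *)
move=> hphi eps0 h0; pose e := Num.min (16^-1) (eps / 6).
have e0 : 0 < e by rewrite lt_min; apply/andP; split; lra.
have e16 : e <= 16^-1 by rewrite ge_min lexx.
have e8 : e < 8^-1 by lra.
have eeps : e <= eps / 6 by rewrite ge_min lexx orbT.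
have e1 : e < 1 by lra.
have [t0 /andP[t00 t0d] ht] := good_scale e0 e1 h0.
have [r1 r10 hr] := level_reached t00; exists r1 => // r r0 rr1.
have [t [t_0 tt0 td rE]] := hr r r0 rr1.
have [hB [G [mG PG HG]]] := ht t t_0 tt0; exists G; split => // w Gw.
have Bt0 : 0 < B t by apply: B_gt0; rewrite t_0.
have tb0 : 0 < t `^ b by exact: powR_gt0.
have Cr : C r = t by rewrite -rE C_inv// t_0.
have rt : r * t `^ b = B t by rewrite -rE divfK// gt_eqF.
have [Y0 small big unif] := HG w Gw.
have [T [TE T1 T2 XT]] :=
  passage_bounds hphi b_ge0 t_0 Bt0 e0 e1 Y0 small big unif.
rewrite rE in TE; rewrite /= TE /= ltry Cr rt.
set x := phi (Y T w) in XT *.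
have x1 : 1 - e <= T / t by rewrite ler_pdivlMr.
have x2 : T / t <= 1 + e by rewrite ler_pdivrMr.
have T0 : 0 < T.
  by apply: lt_le_trans T1; rewrite mulr_gt0//; move: e1; clear_locals; lra.
have xt : `|T / t * B t - B t| <= e * B t.
  have : (1 - e) * B t <= T / t * B t by rewrite ler_pM2r.
  have : T / t * B t <= (1 + e) * B t by rewrite ler_pM2r.
  by move=> ? ?; rewrite ler_norml; apply/andP; split; lra.
have eB : 0 < e * B t by exact: mulr_gt0.
have hx : `|x - B t| <= 2 * e * B t.
  have -> : x - B t = (x - T / t * B t) + (T / t * B t - B t) by ring.
  by apply: (le_trans (ler_normD _ _)); move: XT xt; clear_locals; lra.
have rat q : `|q - B t| <= 2 * e * B t -> `|x / q - 1| <= eps.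
  move=> hq; apply: (le_trans (ratio_near1 Bt0 e0 e8 hx hq)).
  by move: eeps; clear_locals; lra.
have ratB : `|x / B t - 1| <= eps.
  by apply: rat; rewrite subrr normr0; move: eB; clear_locals; lra.
split => //; split => //; apply: rat.
  have -> : r * T `^ b - B t = ((T / t) `^ b - 1) * B t.
    rewrite -rt mulrBl mul1r mulrCA -powRM//; last 2 first.
    - by rewrite divr_ge0 ?(ltW T0) ?(ltW t_0).
    - exact: ltW.
    by rewrite divfK// gt_eqF.
  rewrite normrM (gtr0_norm Bt0).
  have : `|(T / t) `^ b - 1| * B t <= e * B t.
    by rewrite ler_pM2r//; exact: powR_between.
  by move: eB; clear_locals; lra.
have T2t : T <= 2 * t.
  by apply: (le_trans T2); rewrite ler_pM2r//; move: e1; clear_locals; lra.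
have -> : B T - B t = (B T - T / t * B t) + (T / t * B t - B t) by ring.
by apply: (le_trans (ler_normD _ _)); have := hB T T0 T2t;
  move: xt; clear_locals; lra.
Qed.

End Passage.

(** * Determining the sign when only [|X|] is controlled *)

Section Sign.
Context {d : measure_display} {Omega : measurableType d} {R : realType}.
Variable P : probability Omega R.
Variable X : R -> Omega -> R.
Variables (B : R -> R) (b delta : R).
Hypothesis LX : levy_from0 P X.
Hypothesis b_ge0 : 0 <= b.
Hypothesis B_gt0 : forall t : R, 0 < t < delta -> 0 < B t.
Hypothesis B_incr : forall s t : R, 0 < s -> s < t -> t < delta ->
     B s / s `^ b < B t / t `^ b.
Hypothesis conv : forall e h : R, 0 < e -> 0 < h -> exists2 t0,
  0 < t0 < delta & forall t : R, 0 < t < t0 ->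
    pr P [set w | e * B t < `| `|X t w| - B t|] <= h.

Let mX t : measurable_fun setT (X t). Proof. by case: LX. Qed.

Let m0 t (x m : R) : measurable [set w | x < `|X t w - m|].
Proof. exact: (measurable_dev0_gt LX). Qed.

Let mi s t (x m : R) : measurable [set w | x < `|X t w - X s w - m|].
Proof. exact: measurable_dev_gt. Qed.

Let mn t (x m : R) : measurable [set w | x < `| `|X t w| - m|].
Proof.
apply: measurable_dist_gt.
by apply: measurableT_comp; first exact: measurable_realfun.normr_measurable.
Qed.

Let dev e sigma t := pr P [set w | e * B t < `|X t w - sigma * B t|].

(** At a suitable sample point [|X t|] and [|X (2t) - X t|] are at most [9/8 B t], while
    [|X (2t)| >= 7/8 B (2t)]; the triangle inequality gives the factor [18/7 <= 3]. *)
Lemma B_double_le : exists2 t0, 0 < t0 < delta &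
  forall t, 0 < t -> 2 * t < t0 -> B (2 * t) <= 3 * B t.
Proof.
have e0 : 0 < (8^-1 : R) by lra.
have h0 : 0 < (4^-1 : R) by lra.
have [t0 /andP[t00 t0d] ht] := conv e0 h0; exists t0; first by rewrite t00.
move=> t t_0 tt0.
have h1 : 0 < t < t0 by rewrite t_0; lra.
have h2 : 0 < 2 * t < t0 by rewrite tt0 andbT; lra.
pose E3 := [set w | 9 / 8 * B t < `|X (2 * t) w - X t w - 0|].
have P3 : pr P E3 <= 4^-1.
  have t2 : t <= 2 * t by lra.
  rewrite /E3 (pr_incr_dev LX _ _ (ltW t_0) t2).
  have -> : 2 * t - t = t by ring.
  apply: le_trans (ht _ h1); apply: le_pr => // w /=; rewrite subr0 => Xw.
  by apply: lt_le_trans (ler_norm _); lra.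
have := pr_lt1_ex (P := P) (measurableU _ _ (measurableU _ _
   (mn t (8^-1 * B t) (B t))
   (mn (2 * t) (8^-1 * B (2 * t)) (B (2 * t)))) (mi t (2 * t) (9 / 8 * B t) 0)).
case.
  apply: (le_lt_trans (prU3 _ (mn _ _ _) (mn _ _ _) (mi _ _ _ _))).
  by have := ht _ h1; have := ht _ h2; rewrite /E3 in P3; lra.
move=> w /not_orP[/not_orP[]] /= /negP + /negP + /negP; rewrite -!leNgt subr0.
rewrite (ler_norml (`|X t w| - _)) (ler_norml (`|X (2 * t) w| - _)).
move=> /andP[_ a1] /andP[a2 _] a3.
have := ler_normD (X (2 * t) w - X t w) (X t w); rewrite subrK => a4.
have : 0 < B t by apply: B_gt0; lra.
lra.
Qed.

(** The probabilities that [X t] is near [B t] and near [- B t] add up to at least [1 - h]. Their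
    product is at most [h]: by independence it is the probability that [X t] is near [B t] and
    [X (2t) - X t] near [- B t], which makes [|X (2t)|] far smaller than [B (2t)]. *)
Lemma sign_or (e h : R) : 0 < e -> e <= 40^-1 -> 0 < h -> h <= 4^-1 ->
  exists2 t0, 0 < t0 < delta & forall t, 0 < t -> t < t0 ->
    dev e 1 t <= 4 * h \/ dev e (-1) t <= 4 * h.
Proof.
move=> e0 e40 h0 h4.
have [t1 /andP[t10 t1d] ht] := conv e0 h0.
exists (t1 / 2); first by apply/andP; split; lra.
move=> t t_0 tt1.
have t20 : 0 < 2 * t < t1 by apply/andP; split; lra.
have t_1 : 0 < t < t1 by apply/andP; split; lra.
have Bt0 : 0 < B t by apply: B_gt0; rewrite t_0; lra.
have B2t : B t <= B (2 * t) by apply: (B_le b_ge0 B_gt0 B_incr) => //; lra.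
have eB : e * B t <= 40^-1 * B t by rewrite ler_pM2r.
have eB2 : e * B (2 * t) <= 40^-1 * B (2 * t) by rewrite ler_pM2r//; lra.
pose E sigma := [set w | `|X t w - sigma * B t| <= e * B t].
have EC sigma : E sigma = ~` [set w | e * B t < `|X t w - sigma * B t|].
  rewrite /E; apply/seteqP; split => w /=; first by rewrite leNgt => /negP.
  by move=> /negP; rewrite -leNgt.
have mE sigma : measurable (E sigma) by rewrite EC; exact: measurableC.
have PE sigma : pr P (E sigma) = 1 - dev e sigma t by rewrite EC prC.
have sum1 : 1 - h <= pr P (E 1) + pr P (E (-1)).
  apply: le_trans (prU _ (mE _) (mE _)).
  have : 1 - h <= pr P (~` [set w | e * B t < `| `|X t w| - B t|]).
    by rewrite prC//; have := ht _ t_1; lra.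
  move=> /le_trans; apply; apply: le_pr.
  - exact: measurableC.
  - exact: measurableU.
  - move=> w /= /negP; rewrite -leNgt => hw.
    have [x0|x0] := leP 0 (X t w).
      by left; move: hw; rewrite /E /= mul1r (ger0_norm x0).
    right; move: hw; rewrite /E /= (ltr0_norm x0) -normrN.
    by have -> : - (- X t w - B t) = X t w - -1 * B t by ring.
have prod1 : pr P (E 1) * pr P (E (-1)) <= h.
  have [_ indX _ [N [mN PN gN]]] := LX.
  pose tt k : R := k%:R * t.
  have tt0 : 0 <= tt 0 by rewrite /tt mul0r.
  have ttnd i : tt i <= tt i.+1 by rewrite /tt ler_pM2r// ler_nat.
  pose V sigma := [set x : R | `|x - sigma * B t| <= e * B t].
  have mV sigma : measurable (V sigma).
    rewrite (_ : V sigma =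
        `[sigma * B t - e * B t, sigma * B t + e * B t]%classic)//.
    by rewrite /V; apply/seteqP; split => x /=; rewrite in_itv/= ler_distl.
  (* Increment near [B t] over [[0, t]], near [- B t] over [[t, 2t]]. *)
  pose A (i : nat) := V (if i == 0%N then 1 else -1).
  have mA i : measurable (A i) by exact: mV.
  have PI k sigma :
      P [set w | V sigma (X (tt k.+1) w - X (tt k) w)] = (pr P (E sigma))%:E.
    have S : [set w | V sigma (X (tt k.+1) w - X (tt k) w)] =
        ~` [set w | e * B t < `|X (tt k.+1) w - X (tt k) w - sigma * B t|].
      rewrite /V; apply/seteqP; split => w /=; first by rewrite leNgt => /negP.
      by move=> /negP; rewrite -leNgt.
    rewrite S prE; last by exact: measurableC.
    rewrite PE prC// (pr_incr_dev LX)//; last by rewrite /tt mulr_ge0// ltW.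
    by have -> : tt k.+1 - tt k = t by rewrite /tt -natr1; ring.
  have := indep_increments_nat indX tt0 ttnd 2 mA.
  rewrite !big_ord_recl big_ord0 mule1 => PAA.
  pose I := \bigcap_(i in `I_2) [set w | A i (X (tt i.+1) w - X (tt i) w)].
  have mI : measurable I.
    apply: fin_bigcap_measurable; first exact: finite_II.
    move=> i _; rewrite -[X in measurable X]setTI.
    by apply: measurable_realfun.measurable_funB.
  have -> : pr P (E 1) * pr P (E (-1)) = pr P I.
    apply: EFin_inj; rewrite -(prE _ mI) EFinM -(PI 0%N) -(PI 1%N).
    by rewrite -[P I]/(P (\bigcap_(i in `I_2) _)) PAA.
  rewrite -[leRHS]addr0 -PN.
  apply: le_trans (_ : _ <= pr P [set w | e * B (2 * t) <
     `| `|X (2 * t) w| - B (2 * t)|] + pr P N) _; last first.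
    by rewrite lerD2r; exact: ht.
  apply: le_trans (prU _ (mn _ _ _) mN); apply: le_pr => //.
    exact: measurableU.
  move=> w Iw; have [|nN] := pselect (N w); first by right.
  left; have [/= X0 _] := gN w nN.
  have := Iw 0%N isT; have := Iw 1%N isT.
  rewrite /A /V /tt /= mul0r X0 subr0 !mul1r mulN1r => i1 i2 /=.
  move: i1 i2; rewrite !ler_norml => /andP[? ?] /andP[? ?].
  have X2 : `|X (2 * t) w| <= 2 * e * B t.
    by rewrite ler_norml; apply/andP; split; lra.
  rewrite -normrN; apply: lt_le_trans (ler_norm _); lra.
have p1 : pr P (E 1) <= 1 by exact: pr_le1.
have p2 : pr P (E (-1)) <= 1 by exact: pr_le1.
have q1 := pr_ge0 P (E 1); have q2 := pr_ge0 P (E (-1)).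
rewrite PE in sum1 prod1 p1 q1; rewrite PE in sum1 prod1 p2 q2.
move: sum1 prod1 p1 q1 p2 q2; set x := dev e 1 t; set y := dev e (-1) t.
move=> s1 s2 p1 q1 p2 q2.
(* The larger probability is at least [(1 - h) / 2 >= 3/8], so the smaller is at most [8/3 h], and
   the larger is at least [1 - 11/3 h]. *)
have [xy|xy] := leP x y; [left|right].
  have : (1 - x) * (1 - y) >= (3 / 8) * (1 - y) by apply: ler_wpM2r; lra.
  lra.
have : (1 - x) * (1 - y) >= (1 - x) * (3 / 8) by apply: ler_wpM2l; lra.
lra.
Qed.

(** Opposite signs at [s] and [t] would make [|X t - X s|] about [B t + B s], while it is at most
    [41/40 B (t - s) <= 41/40 B t]. The tolerances then leave [39/40 B s <= 1/20 B t <= 3/20 B s],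
    which is absurd. *)
Lemma sign_locally_constant : exists2 t0, 0 < t0 < delta & forall sigma s t,
  `|sigma| = 1 -> 0 < s -> s < t -> t <= 2 * s -> 2 * s < t0 ->
  dev (40^-1) sigma t <= 10^-1 -> 10^-1 < dev (40^-1) (- sigma) s.
Proof.
have [t1 /andP[t10 t1d] hB] := B_double_le.
have e0 : 0 < (40^-1 : R) by lra.
have [t2 /andP[t20 t2d] hn] := conv e0 e0.
exists (Num.min t1 t2); first by rewrite lt_min t10 t20 gt_min t1d.
move=> sigma s t sigma1 s0 st ts; rewrite lt_min => /andP[s1 s2] dt.
rewrite ltNge; apply/negP => ds.
have u0 : 0 < t - s < t2 by apply/andP; split; lra.
pose E3 := [set w | 41 / 40 * B (t - s) < `|X t w - X s w - 0|].
have Bts : B (t - s) <= B t by apply: (B_le b_ge0 B_gt0 B_incr); lra.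
have B2s : B t <= 3 * B s.
  by apply: le_trans (hB s s0 s1); apply: (B_le b_ge0 B_gt0 B_incr); lra.
have P3 : pr P E3 <= 40^-1.
  rewrite /E3 (pr_incr_dev LX _ _ (ltW s0) (ltW st)).
  apply: le_trans (hn _ u0); apply: le_pr => // w /=; rewrite subr0 => Xw.
  by apply: lt_le_trans (ler_norm _); lra.
have := pr_lt1_ex (P := P) (measurableU _ _ (measurableU _ _
   (m0 t (40^-1 * B t) (sigma * B t)) (m0 s (40^-1 * B s) (- sigma * B s)))
   (mi s t (41 / 40 * B (t - s)) 0)).
case.
  apply: (le_lt_trans (prU3 _ (m0 _ _ _) (m0 _ _ _) (mi _ _ _ _))).
  by rewrite /E3 in P3; rewrite /dev in dt ds; lra.
move=> w /not_orP[/not_orP[]] /= /negP + /negP + /negP; rewrite -!leNgt subr0.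
move=> a1 a2 a3.
have Bs0 : 0 < B s by apply: B_gt0; lra.
have Bt0 : 0 < B t by apply: B_gt0; lra.
have : `|sigma * (B t + B s)| = B t + B s.
  by rewrite normrM sigma1 mul1r gtr0_norm// addr_gt0.
have -> : sigma * (B t + B s) = (X t w - X s w) -
    ((X t w - sigma * B t) - (X s w - - sigma * B s)) by ring.
have := ler_normB (X t w - X s w)
  ((X t w - sigma * B t) - (X s w - - sigma * B s)).
have := ler_normB (X t w - sigma * B t) (X s w - - sigma * B s).
lra.
Qed.

(** A sign is fixed at one time [ts] and propagated to all smaller times at the coarse tolerance
    1/40; at finer tolerances [sign_or] offers some sign, which must be the same one. *)
Lemma sign_dichotomy : exists2 sigma, sigma = 1 \/ sigma = -1 &
  forall e h : R, 0 < e -> 0 < h -> exists2 t0, 0 < t0 < delta &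
    forall t : R, 0 < t < t0 ->
      pr P [set w | e * B t < `|X t w - sigma * B t|] <= h.
Proof.
have e0 : 0 < (40^-1 : R) by lra.
have e4 : (40^-1 : R) <= 4^-1 by lra.
have [t1 /andP[t10 t1d] or1] := sign_or e0 (lexx _) e0 e4.
have {}or1 t : 0 < t -> t < t1 ->
    dev 40^-1 1 t <= 10^-1 \/ dev 40^-1 (-1) t <= 10^-1.
  by move=> a1 a2; case: (or1 t a1 a2) => ?; [left|right]; lra.
have [t2 /andP[t20 t2d] loc] := sign_locally_constant.
pose ts := Num.min t1 t2 / 2.
have ts0 : 0 < ts by rewrite divr_gt0// lt_min t10.
have m1 : Num.min t1 t2 <= t1 by rewrite ge_min lexx.
have m2 : Num.min t1 t2 <= t2 by rewrite ge_min lexx orbT.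
have ts1 : ts < t1 by rewrite /ts; lra.
have ts2 : 2 * ts <= t2 by rewrite /ts; lra.
have [sigma sigmaE dts] : exists2 sigma : R, sigma = 1 \/ sigma = -1 &
    dev 40^-1 sigma ts <= 10^-1.
  by case: (or1 ts ts0 ts1) => ?; [exists 1|exists (-1)] => //; [left|right].
have sigma1 : `|sigma| = 1 by case: sigmaE => ->; rewrite ?normrN normr1.
have or2 t : 0 < t -> t < t1 ->
    dev 40^-1 sigma t <= 10^-1 \/ dev 40^-1 (- sigma) t <= 10^-1.
  move=> a1 a2; case: (or1 t a1 a2) => ?; case: sigmaE => ->; rewrite ?opprK;
    by [left|right].
(* Induction on halvings: a time in [[u / 2, u)] inherits the sign found at [u]. *)
have chain n s : ts / 2 ^+ n <= s -> s <= ts -> 0 < s ->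
    dev 40^-1 sigma s <= 10^-1.
  elim: n s => [|n IH] s sn sts s0.
    have -> : s = ts by apply/le_anti; rewrite sts -[ts]divr1.
    exact: dts.
  have p0 : 0 < (2 : R) ^+ n by rewrite exprn_gt0.
  have [|sn'] := leP (ts / 2 ^+ n) s; first by move=> /IH; apply.
  set u := ts / 2 ^+ n in sn' IH.
  have u0 : 0 < u by exact: divr_gt0.
  have uts : u <= ts.
    by rewrite ler_pdivrMr// -[leLHS]mulr1 ler_pM2l// exprn_ege1// ler1n.
  have us : u <= 2 * s.
    move: sn; have -> : ts / 2 ^+ n.+1 = u / 2 by rewrite /u exprS invfM; ring.
    lra.
  case: (or2 s s0 (le_lt_trans sts ts1)) => // bad.
  have s2 : 2 * s < t2 by lra.
  have := loc sigma s u sigma1 s0 sn' us s2 (IH u (lexx _) uts u0).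
  by rewrite ltNge bad.
exists sigma => // e h e_0 h_0.
(* [h / 4] and [1/40] make the bound [4 h'] of [sign_or] at most [h] and [1/10]; [e' <= 1/40] allows
   comparison with [chain]. *)
pose e' := Num.min e (40^-1); pose h' := Num.min (h / 4) (40^-1).
have e'0 : 0 < e' by rewrite lt_min e_0 e0.
have h'0 : 0 < h' by rewrite lt_min e0 divr_gt0.
have e'40 : e' <= 40^-1 by rewrite ge_min lexx orbT.
have e'e : e' <= e by rewrite ge_min lexx.
have h'40 : h' <= 40^-1 by rewrite ge_min lexx orbT.
have h'h : h' <= h / 4 by rewrite ge_min lexx.
have h'4 : h' <= 4^-1 by lra.
have [t3 /andP[t30 t3d] or3] := sign_or e'0 e'40 h'0 h'4.
exists (Num.min ts t3); first by rewrite lt_min ts0 t30 gt_min t3d orbT.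
move=> t; rewrite lt_min => /and3P[t_0 tts tt3].
have Bt0 : 0 < B t by apply: B_gt0; lra.
have mono e1 e2 tau : e1 <= e2 -> dev e2 tau t <= dev e1 tau t.
  move=> e12; apply: le_pr => // w /=; apply: le_lt_trans.
  by rewrite ler_pM2r.
have fin : dev e' sigma t <= 4 * h' -> dev e sigma t <= h.
  by move=> l; apply: (le_trans (mono _ _ _ e'e)); lra.
suff : dev e' sigma t <= 4 * h' \/ dev e' (- sigma) t <= 4 * h'.
  (* Otherwise some sample point has [X t] near both [sigma * B t] and [- sigma * B t]. *)
  case=> // bad; exfalso.
  have dm : dev 40^-1 (- sigma) t <= 10^-1.
    by apply: (le_trans (mono _ _ _ e'40)); lra.
  have [n tn] := exp_half_lt ts t_0.
  have dp := chain n t (ltW tn) (ltW tts) t_0.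
  have := pr_lt1_ex (P := P) (measurableU _ _ (m0 t (40^-1 * B t) (sigma * B t))
    (m0 t (40^-1 * B t) (- sigma * B t))).
  case.
    apply: (le_lt_trans (prU _ (m0 _ _ _) (m0 _ _ _))).
    by rewrite /dev in dm dp; lra.
  move=> w /not_orP[] /= /negP + /negP; rewrite -!leNgt => a1 a2.
  have : `|sigma * (2 * B t)| = 2 * B t.
    by rewrite normrM sigma1 mul1r gtr0_norm// mulr_gt0.
  have -> : sigma * (2 * B t) =
     (X t w - - sigma * B t) - (X t w - sigma * B t) by ring.
  have := ler_normB (X t w - - sigma * B t) (X t w - sigma * B t).
  lra.
have [?|?] := or3 t t_0 tt3; case: sigmaE => ->; rewrite ?opprK;
  by [left|right].
Qed.

End Sign.

(** * Convergence in probability, and the process with its negative *)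

Section InProbability.
Context {d : measure_display} {Omega : measurableType d} {R : realType}.
Variable P : probability Omega R.

Lemma cvg_in_prob_pr (Z : R -> Omega -> R) (B : R -> R) (delta e h : R) :
  0 < delta -> (forall t, 0 < t < delta -> 0 < B t) ->
  cvg_in_prob P (fun t w => Z t w / B t) 1 -> 0 < e -> 0 < h ->
  exists2 t0, 0 < t0 < delta & forall t, 0 < t < t0 ->
    pr P [set w | e * B t < `|Z t w - B t|] <= h.
Proof.
move=> d0 B0 cv e0 h0.
have /fine_cvgP[_ /cvgr0Pnorm_le/(_ h h0)/near_right_ex[t1 t10 ht]] := cv e e0.
exists (Num.min t1 (delta / 2)).
  rewrite lt_min t10 divr_gt0//= gt_min; apply/orP; right; lra.
move=> t; rewrite lt_min => /and3P[t_0 tt1 td].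
have Bt0 : 0 < B t by apply: B0; lra.
have := ht t; rewrite add0r t_0 tt1 => /(_ isT); apply: le_trans.
rewrite /= ger0_norm ?fine_ge0// le_eqVlt; apply/orP; left; apply/eqP.
congr (fine (P _)); apply/seteqP; split => w /=; rewrite -ltr_pdivlMr//.
  rewrite -[X in _ -> _ < `|_ - X|](divff (lt0r_neq0 Bt0)) -mulrBl.
  by rewrite normrM normfV (gtr0_norm Bt0).
rewrite -[X in _ < `|_ - X| -> _](divff (lt0r_neq0 Bt0)) -mulrBl.
by rewrite normrM normfV (gtr0_norm Bt0).
Qed.

Lemma mu_ext_cvg0 (A : R -> set Omega) :
  (forall h : R, 0 < h -> exists2 r1, 0 < r1 & forall r, 0 < r -> r < r1 ->
     exists G, [/\ measurable G, pr P (~` G) <= h & A r `<=` ~` G]) ->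
  mu_ext P (A r) @[r --> 0^'+] --> 0%E.
Proof.
move=> hA; have near_le (h : R) : 0 < h ->
    \forall r \near 0^'+, (mu_ext P (A r) <= h%:E)%E.
  move=> h0; apply/near_right_ex; have [r1 r10 hr] := hA h h0.
  exists r1 => // r; rewrite add0r => /andP[r0 rr1].
  have [G [mG PG AG]] := hr r r0 rr1.
  have mGC : measurable (~` G) by exact: measurableC.
  apply: (le_trans (le_mu_ext P AG)).
  have -> : mu_ext P (~` G) = P (~` G) by exact: measurable_mu_extE.
  by rewrite prE// lee_fin.
apply/fine_cvgP; split.
  near=> r; rewrite ge0_fin_numE ?mu_ext_ge0//.
  by apply: (@le_lt_trans _ _ 1%:E); [near: r; exact: near_le|exact: ltry].
apply/cvgr0Pnorm_le => e e0; near=> r.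
rewrite /= ger0_norm ?fine_ge0 ?mu_ext_ge0//.
have le_e : (mu_ext P (A r) <= e%:E)%E by near: r; exact: near_le.
rewrite -lee_fin fineK// ge0_fin_numE ?mu_ext_ge0//.
exact: le_lt_trans le_e (ltry _).
Unshelve. all: by end_near. Qed.

Lemma cvg_in_prob_onP (D : R -> set Omega) (Z : R -> Omega -> R) :
  (forall eps h : R, 0 < eps -> 0 < h -> exists2 r1, 0 < r1 & forall r,
     0 < r -> r < r1 -> exists G, [/\ measurable G, pr P (~` G) <= h &
       forall w, G w -> D r w /\ `|Z r w - 1| <= eps]) ->
  cvg_in_prob_on P D Z 1.
Proof.
move=> hZ; split=> [|eps eps0]; apply: mu_ext_cvg0 => h h0.
  have [r1 r10 hr] := hZ 1 h ltr01 h0; exists r1 => // r r0 rr1.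
  have [G [mG PG HG]] := hr r r0 rr1; exists G; split => // w nD Gw.
  by have [] := HG w Gw.
have [r1 r10 hr] := hZ eps h eps0 h0; exists r1 => // r r0 rr1.
have [G [mG PG HG]] := hr r r0 rr1; exists G; split => // w [_ /= Zw] Gw.
by have [_] := HG w Gw; rewrite leNgt Zw.
Qed.

Lemma levy_from0_of (X : R -> {RV P >-> R}) :
  levy_process X -> {ae P, forall w, X 0 w = 0} -> levy_from0 P X.
Proof.
move=> [ind stat [N1 [mN1 PN1 cN1]]] [N2 [mN2 PN2 cN2]]; split => //.
exists (N1 `|` N2); split; first exact: measurableU.
  apply/le_anti; rewrite pr_ge0 andbT; apply: (le_trans (prU _ mN1 mN2)).
  by rewrite /pr [X in fine X + _]PN1 [X in _ + fine X]PN2 addr0.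
move=> w /not_orP[n1 n2]; split.
  by apply: contrapT => h; apply: n2; exact: cN2.
have [rc _] : cadlag (fun t => X t w).
  by apply: contrapT => h; apply: n1; exact: cN1.
exact: rc.
Qed.

(** Laws and independence of the increments transfer by pulling Borel sets back along negation. It
    serves the case where [X] is asymptotic to [- B]. *)
Lemma levy_from0_opp (Y : R -> Omega -> R) :
  levy_from0 P Y -> levy_from0 P (fun t w => - Y t w).
Proof.
move=> [mY ind stat [N [mN PN gN]]].
have mopp (A : set R) : measurable A -> measurable (-%R @^-1` A).
  move=> mA; rewrite -[X in measurable X]setTI.
  exact: (measurable_realfun.oppr_measurable (D := setT)).
have dE s t w : - Y t w - - Y s w = - (Y t w - Y s w).
  by rewrite opprB opprK addrC.
split.
- by move=> t; exact: measurable_realfun.measurable_funN.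
- move=> n t t0 tnd A mA.
  have := ind n t t0 tnd (fun i => -%R @^-1` A i) (fun i => mopp _ (mA i)).
  have E (i : 'I_n) : (fun w => - Y (t i.+1) w - - Y (t i) w) @^-1` A i =
      (fun w => Y (t i.+1) w - Y (t i) w) @^-1` (-%R @^-1` A i).
    by apply/seteqP; split => w /=; rewrite dE.
  rewrite (eq_bigcapr (fun i _ => E i)) => ->.
  by apply: eq_bigr => i _; rewrite E.
- move=> s t s0 st A mA; have := stat s t s0 st _ (mopp A mA).
  rewrite /=.
  by under eq_set do rewrite -dE; under [in RHS]eq_set do rewrite -dE.
- exists N; split => // w /gN[/= Y0 rc]; split; first by rewrite /= Y0 oppr0.
  by move=> t t0; apply: cvgN; exact: rc.
Qed.

End InProbability.

(** * The four ratios as limits in probability *)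

Section Assembly.
Context {d : measure_display} {Omega : measurableType d} {R : realType}.
Variable P : probability Omega R.
Variable Y : R -> Omega -> R.
Variables (B C : R -> R) (b delta : R).
Hypothesis LY : levy_from0 P Y.
Hypothesis b_ge0 : 0 <= b.
Hypothesis b_lt1 : b < 1.
Hypothesis B_gt0 : forall t : R, 0 < t < delta -> 0 < B t.
Hypothesis B_cont : forall t : R, 0 < t < delta ->
     {for t, continuous (fun s => B s / s `^ b)}.
Hypothesis B_incr : forall s t : R, 0 < s -> s < t -> t < delta ->
     B s / s `^ b < B t / t `^ b.
Hypothesis C_inv : forall t : R, 0 < t < delta -> C (B t / t `^ b) = t.
Hypothesis conv : forall e h : R, 0 < e -> 0 < h -> exists2 t0,
  0 < t0 < delta & forall t : R, 0 < t < t0 ->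
    pr P [set w | e * B t < `|Y t w - B t|] <= h.

(** [Z] is kept apart from [phi (Y t w)] so that [|X|] can also be presented as the absolute value
    of [-X]. *)
Lemma passage_ratios_cvg phi (Z : R -> Omega -> R) : size_like phi ->
  (forall t w, Z t w = phi (Y t w)) ->
  let T := fun r w => passage (Z ^~ w) b r in
  let fin := fun r => [set w | (T r w < +oo)%E] in
  let t := fun r w => fine (T r w) in
  let ZT := fun r w => Z (t r w) w in
  [/\ cvg_in_prob_on P fin (fun r w => ZT r w / (r * t r w `^ b)) 1,
      cvg_in_prob_on P fin (fun r w => ZT r w / B (t r w)) 1,
      cvg_in_prob_on P fin (fun r w => ZT r w / B (C r)) 1 &
      cvg_in_prob_on P fin (fun r w => ZT r w / (r * C r `^ b)) 1].
Proof.
move=> hphi hZ; have -> : Z = fun t w => phi (Y t w).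
  by apply/funext => t; apply/funext => w.
move=> T fin t ZT.
have main := passage_ratios LY b_ge0 b_lt1 B_gt0 B_cont B_incr C_inv conv hphi.
split; apply: cvg_in_prob_onP => eps h eps0 h0;
  have [r1 r10 hr] := main _ _ eps0 h0; exists r1 => // r r0 rr1;
  have [G [mG PG HG]] := hr r r0 rr1; exists G; split => // w Gw;
  by have [finw [? ? ? ?]] := HG w Gw.
Qed.

End Assembly.

Theorem theorem3p3 (d : measure_display) (Omega : measurableType d)
  (R : realType) (P : probability Omega R) (X : R -> {RV P >-> R})
  (b : R) (B C : R -> R) (delta : R)
  (X_levy : levy_process X) (X0 : {ae P, forall w, X 0 w = 0})
  (b_ge0 : 0 <= b) (b_lt1 : b < 1)
  (delta_gt0 : 0 < delta)
  (B_gt0 : forall t, 0 < t < delta -> 0 < B t)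
  (B_cont : forall t, 0 < t < delta ->
     {for t, continuous (fun s => B s / s `^ b)})
  (B_incr : forall s t, 0 < s -> s < t -> t < delta ->
     B s / s `^ b < B t / t `^ b)
  (C_inv : forall t, 0 < t < delta -> C (B t / t `^ b) = t) :
  (cvg_in_prob P (fun t w => X t w / B t) 1 ->
    let T := Tbar X b in
    let fin := fun r => [set w | (T r w < +oo)%E] in
    let t := fun r w => fine (T r w) in
    let XT := fun r w => X (t r w) w in
    [/\ cvg_in_prob_on P fin (fun r w => XT r w / (r * t r w `^ b)) 1,
        cvg_in_prob_on P fin (fun r w => XT r w / B (t r w)) 1,
        cvg_in_prob_on P fin (fun r w => XT r w / B (C r)) 1 &
        cvg_in_prob_on P fin (fun r w => XT r w / (r * C r `^ b)) 1])
  /\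
  (cvg_in_prob P (fun t w => `|X t w| / B t) 1 ->
    let T := Tstar X b in
    let fin := fun r => [set w | (T r w < +oo)%E] in
    let t := fun r w => fine (T r w) in
    let XT := fun r w => `|X (t r w) w| in
    [/\ cvg_in_prob_on P fin (fun r w => XT r w / (r * t r w `^ b)) 1,
        cvg_in_prob_on P fin (fun r w => XT r w / B (t r w)) 1,
        cvg_in_prob_on P fin (fun r w => XT r w / B (C r)) 1 &
        cvg_in_prob_on P fin (fun r w => XT r w / (r * C r `^ b)) 1]).
Proof.
have LX := levy_from0_of X_levy X0.
split=> cv.
  have conv e h := cvg_in_prob_pr (e := e) (h := h) delta_gt0 B_gt0 cv.
  exact: (passage_ratios_cvg LX b_ge0 b_lt1 B_gt0 B_cont B_incr C_inv conv
    size_like_id (fun t w => erefl)).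
have convn e h := cvg_in_prob_pr (e := e) (h := h) delta_gt0 B_gt0 cv.
(* [Tstar] and the ratios in (b) depend on [|X|] only, so [X] may be replaced by whichever of [X]
   and [-X] is asymptotic to [B]. *)
have [sigma sigmaE conv] := sign_dichotomy LX b_ge0 B_gt0 B_incr convn.
case: sigmaE conv => -> conv.
  apply: (passage_ratios_cvg LX b_ge0 b_lt1 B_gt0 B_cont B_incr C_inv _
    size_like_norm (fun t w => erefl)) => e h e0 h0.
  have [t0 t0d ht] := conv e h e0 h0; exists t0 => // t /ht.
  by under eq_set do rewrite mul1r.
have LXN := levy_from0_opp LX.
have convN e h : 0 < e -> 0 < h -> exists2 t0, 0 < t0 < delta &
    forall t, 0 < t < t0 -> pr P [set w | e * B t < `|- X t w - B t|] <= h.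
  move=> e0 h0; have [t0 t0d ht] := conv e h e0 h0; exists t0 => // t /ht.
  rewrite (_ : [set w | e * B t < `|X t w - -1 * B t|] =
               [set w | e * B t < `|- X t w - B t|])//.
  apply/seteqP; split => w /=;
    by rewrite -(normrN (- X t w - B t)) opprB opprK mulN1r opprK addrC.
exact: (passage_ratios_cvg LXN b_ge0 b_lt1 B_gt0 B_cont B_incr C_inv convN
  size_like_norm (fun t w => esym (normrN (X t w)))).
Qed.
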